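(* Assume that $E$ is not compact and that the following two conditions hold. (i) The mapping $E\times U\ni(x,a)\mapsto \mathbb{P}^a(x,\cdot)$ is continuous in variation norm, i.e. whenever $a_k\to a$ in $U$ and $x_k\to x$ in $E$, then $\sup_{A\in\mathcal{E}}|\mathbb{P}^{a_k}(x_k,A)-\mathbb{P}^a(x,A)|\to 0$ as $k\to\infty$. (ii) For each $n\in\mathbb{N}$, each $x\in B_n$ and each open set $O\subset E$ with $O\cap B_n\neq\emptyset$ there is $m\in\mathbb{N}$ such that $\inf_{V_m}(\hat{\mathbb{P}}_n^{V_m})^m(x,O)>0$, the infimum being over all $m$-step adapted strategies $V_m$. For each $n\in\mathbb{N}$ let $w_n\in C(E)$ and $\lambda_n\in\mathbb{R}$ (which exist under (i) and (ii)) satisfy $$e^{w_n(x)}=\inf_{a\in U}\left[e^{c_n(x,a)-\lambda_n}\int_E e^{w_n(y)}\,\tilde{\mathbb{P}}_n^a(x,dy)\right]\ \ (x\in E),\qquad \sup_{x\in B_{n+1}}w_n(x)=0,$$ and let $\lambda:=\limsup_{n\to\infty}\lambda_n$. Assume moreover that at least one of the following holds: (iii) there is $\varepsilon>0$ such that the set $\{x\in E:\check c(x)\ge\lambda-\varepsilon\}$ is compact, where $\check c(x):=\inf_{a\in U}c(x,a)$; (iv) there are $x\in E$, $m,N\in\mathbb{N}$ and $\varepsilon>0$ such that $\inf_{n\ge N}\inf_{V_m}(\hat{\mathbb{P}}_n^{V_m})^m(x,\mathcal{O}_n(\varepsilon))>0$, where $\mathcal{O}_n(\varepsilon)=\{y\in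 E:e^{w_n(y)}>\varepsilon\}$. Then there is a continuous function $w:E\to\mathbb{R}$ such that $\sup_{x\in E}w(x)=0$ and $$e^{w(x)}=\inf_{a\in U}\left[e^{c(x,a)-\lambda}\int_E e^{w(y)}\,\mathbb{P}^a(x,dy)\right]\quad\text{for all }x\in E.$$
   Context: Setting. $(E,\rho)$ is a locally compact separable metric space with Borel $\sigma$-field $\mathcal{E}$; $b\in E$ is a fixed point, $\mathbb{N}$ is the set of positive integers, $B_n:=\{x\in E:\rho(b,x)\le n\}$ for $n\in\mathbb{N}$, and each $B_n$ is compact. $U$ is a nonempty compact metric space (set of control parameters). For $x\in E$, $a\in U$, $\mathbb{P}^a(x,\cdot)$ is a probability measure on $(E,\mathcal{E})$, and $(x,a)\mapsto\mathbb{P}^a(x,D)$ is Borel measurable for each $D\in\mathcal{E}$. The function $c:E\times U\to\mathbb{R}$ is continuous, bounded and not constant; $\bar c:=\sup_{x\in E,a\in U}c(x,a)$, $\underline c:=\inf_{x\in E,a\in U}c(x,a)$, and $\bar c\ge 0$. $C(E)$ is the space of bounded continuous real functions on $E$. Approximating objects. $\mu$ is a fixed probability measure on $E$ with support $D\subset B_1$. $\rho(x,B_n)$ is the distance from $x$ to $B_n$, $(\cdot)^+$ is the positive part, $s\wedge t=\min\{s,t\}$, $B_n^c=E\setminus B_n$. For $n\in\mathbb{N}$, $x\in E$, $a\in U$, $A\in\mathcal{E}$: $$\tilde{\mathbb{P}}_n^a(x,A)=(1-\rho(x,B_n))^+\mathbb{P}^a(x,A\cap B_n)+\mu(A)\left[\mathbb{P}^a(x,B_n^c)+(\rho(x,B_n)\wedge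 1)(1-\mathbb{P}^a(x,B_n^c))\right],$$ $$c_n(x,a)=(1-\rho(x,B_n))^+c(x,a)+(\rho(x,B_n)\wedge 1)\,\underline c .$$ Strategies. The controlled Markov process $(X_i)$ lives on a filtered probability space with filtration $(F_i)$; a strategy is a sequence of $U$-valued controls $(a_0,a_1,\ldots)$ with $a_i$ being $F_i$-measurable, and under it, given $F_i$, the law of $X_{i+1}$ is $\mathbb{P}^{a_i}(X_i,\cdot)$. $V_m$ denotes the (finite) initial part of such a strategy that governs the first $m$ steps, and $(\hat{\mathbb{P}}_n^{V_m})^m(x,A)$ is the probability, starting from $X_0=x$ and using $V_m$, that $X_1,\ldots,X_m\in B_n$ and $X_m\in A$. *)

(* Defs.v *)
From HB Require Import structures.
From mathcomp Require Import all_boot all_order all_algebra.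
From mathcomp Require Import all_classical all_reals all_analysis.
From mathcomp Require Import measurable_realfun.

Set Implicit Arguments.
Unset Strict Implicit.
Unset Printing Implicit Defensive.

Import Order.TTheory GRing.Theory Num.Theory.
Import numFieldNormedType.Exports.

Local Open Scope classical_set_scope.
Local Open Scope ring_scope.

(* The library's measurable types carry a distinguished point, hence pointed
   metric spaces; the point plays no role beyond nonemptiness. *)
#[short(type="pmetricType")]
HB.structure Definition PointedMetric (R : numDomainType) :=
  {M of Pointed M & Metric R M}.

Notation borel T := (g_sigma_algebraType (@open T)).

Definition separable (T : topologicalType) : Prop :=
  exists S : set T, countable S /\ dense S.

Definition msupport (R : realType) (E : pmetricType R)
    (mu : probability (borel E) R) : set E :=
  [set x | forall O : set E, open O -> O x -> (0 < mu O)%E].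

(* The library's [closed_ball] is the closure of the open ball, which may be
   smaller than this set in a general metric space. *)
Definition Bn (R : realType) (E : pmetricType R) (b : E) (n : nat) : set E :=
  [set x | mdist b x <= n%:R].

Definition dist_set (R : realType) (E : pmetricType R) (x : E) (A : set E) : R :=
  inf [set mdist x y | y in A].

Lemma measurable_Bn (R : realType) (E : pmetricType R) (b : E) (n : nat) :
  measurable (Bn b n : set (borel E)).
Proof.
rewrite -[Bn b n]setCK; apply: measurableC; apply: sub_sigma_algebra.
rewrite openE => x /= /negP; rewrite -ltNge => nx.
apply/nbhs_ballP; exists (mdist b x - n%:R) => /=; first by rewrite subr_gt0.
move=> y; rewrite ballEmdist/= => xy /=; apply/negP; rewrite -ltNge.
have := metric_triangle b y x; rewrite [mdist y x]metric_sym.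
by move: xy; rewrite ltrBrDr addrC -ltrBrDr -lerBlDr; exact: lt_le_trans.
Qed.

Section tildeP.
Local Open Scope ereal_scope.
Variables (R : realType) (E U : pmetricType R) (b : E).
Variables (mu : probability (borel E) R) (P : E -> U -> probability (borel E) R).
Variables (n : nat) (x : E) (a : U).

Let d := dist_set x (Bn b n).

Definition tildeP (A : set (borel E)) : \bar R :=
  (Num.max 0 (1 - d))%R%:E * P x a (A `&` Bn b n) +
  mu A * (P x a (~` Bn b n) + (Num.min d 1)%R%:E * (1 - P x a (~` Bn b n))).

Let k1_ge0 : (0 <= Num.max 0 (1 - d))%R. Proof. by rewrite le_max lexx. Qed.

Let d_ge0 : (0 <= d)%R.
Proof.
have b_in : Bn b n b by rewrite /Bn/= mdistxx ler0n.
by apply: lb_le_inf; [exists (mdist x b), b | move=> _ [y _ <-]; exact: mdist_ge0].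
Qed.

Let k2 : R :=
  (fine (P x a (~` Bn b n)) + Num.min d 1 * (1 - fine (P x a (~` Bn b n))))%R.

Let mBnC : measurable (~` Bn b n : set (borel E)).
Proof. by apply: measurableC; exact: measurable_Bn. Qed.

Let k2_ge0 : (0 <= k2)%R.
Proof.
rewrite addr_ge0 ?fine_ge0// mulr_ge0//; first by rewrite le_min d_ge0 ler01.
rewrite subr_ge0 -lee_fin fineK; first exact: probability_le1.
exact: fin_num_measure.
Qed.

Let m : {measure set (borel E) -> \bar R} := measure_add
  (mscale (NngNum k1_ge0) (mrestr (P x a) (measurable_Bn b n)))
  (mscale (NngNum k2_ge0) mu).

Let tildePE : tildeP = m.
Proof.
apply/funext => A; rewrite [RHS]measure_addE/= /mscale/= /mrestr /tildeP.
congr (_ + _); rewrite [RHS]muleC; congr (_ * _).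
by rewrite /k2 EFinD EFinM EFinB fineK//; exact: fin_num_measure.
Qed.

Let tildeP0 : tildeP set0 = 0. Proof. by rewrite tildePE measure0. Qed.

Let tildeP_ge0 A : 0 <= tildeP A. Proof. by rewrite tildePE measure_ge0. Qed.

Let tildeP_semi_sigma_additive : semi_sigma_additive tildeP.
Proof. by rewrite tildePE; exact: measure_semi_sigma_additive. Qed.

HB.instance Definition _ :=
  isMeasure.Build _ _ _ tildeP tildeP0 tildeP_ge0 tildeP_semi_sigma_additive.

End tildeP.

Definition cn (R : realType) (E U : pmetricType R) (b : E) (c : E -> U -> R)
    (n : nat) (x : E) (a : U) : R :=
  Num.max 0 (1 - dist_set x (Bn b n)) * c x a +
  Num.min (dist_set x (Bn b n)) 1 * inf [set c xa.1 xa.2 | xa in [set: E * U]].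

(* The last field says that, given F i, the law of X i.+1 is
   P (X i) (a i): the defining identity of conditional probability. *)
Record controlled_process (R : realType) (E U : pmetricType R)
    (P : E -> U -> probability (borel E) R) (x : E) (m : nat)
    (d : measure_display) (Omega : measurableType d) (Pr : probability Omega R)
    (F : nat -> set (set Omega)) (X : nat -> Omega -> borel E)
    (a : nat -> Omega -> borel U) : Prop := {
  cp_sigma : forall i, sigma_algebra [set: Omega] (F i) ;
  cp_filtration : forall i, F i `<=` F i.+1 ;
  cp_measurable : forall i, F i `<=` measurable ;
  cp_start : forall omega, X 0%N omega = x ;
  cp_state : forall i, (i <= m)%N ->
    forall D, measurable D -> F i (X i @^-1` D) ;
  cp_control : forall i, (i < m)%N ->
    forall D, measurable D -> F i (a i @^-1` D) ;
  cp_transition : forall i, (i < m)%N ->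
    forall G D, F i G -> measurable D ->
      Pr (G `&` X i.+1 @^-1` D) =
      (\int[Pr]_(omega in G) P (X i omega) (a i omega) D)%E }.

(* The infimum over V_m, taken over all filtered probability spaces and all
   adapted controls, of the probability that X_1, ..., X_m lie in B_n and X_m
   lies in A. *)
Definition inf_hatP (R : realType) (E U : pmetricType R) (b : E)
    (P : E -> U -> probability (borel E) R) (n m : nat) (x : E) (A : set E) :
    \bar R :=
  ereal_inf [set p | exists (d : measure_display) (Omega : measurableType d)
      (Pr : probability Omega R) (F : nat -> set (set Omega))
      (X : nat -> Omega -> borel E) (a : nat -> Omega -> borel U),
      controlled_process P x m Pr F X a /\
      p = Pr [set omega | (forall i, (1 <= i <= m)%N -> Bn b n (X i omega)) /\
                          A (X m omega)]].

(* Main.v *)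
Require Import Defs.
From HB Require Import structures.
From mathcomp Require Import finmap.
From mathcomp Require Import all_boot all_order all_algebra.
From mathcomp Require Import all_classical all_reals all_analysis.
From mathcomp Require Import measurable_realfun.
From mathcomp Require Import ring lra.

Set Implicit Arguments.
Unset Strict Implicit.
Unset Printing Implicit Defensive.

Import Order.TTheory GRing.Theory Num.Theory.
Import numFieldNormedType.Exports.

Local Open Scope classical_set_scope.
Local Open Scope ring_scope.

(** With [u_n = exp w_n], every [x] in [B_n] satisfies
    [u_n x = inf_a e^(c(x,a) - lambda_n) \int g_n dP^a(x)], where [g_n] equals
    [u_n] on [B_n] and the constant [\int u_n dmu] off [B_n].  Since
    [0 <= g_n <= 1], continuity in variation makes the [u_n] equicontinuous at
    every point, uniformly in the control.  Choose a subsequence with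
    [lambda_n --> lambda] and let [u] be its pointwise limit along an
    ultrafilter: the convergence is uniform on each [B_j] and the [P^a(x)] are
    tight uniformly in [a], so [u] is continuous and solves the limit equation.
    Now [u] is not identically zero: under (iii) the near-maximisers of [w_n]
    on [B_n+1] have cost at least [lambda - eps], hence stay in a fixed compact
    set; under (iv) iterating the equation bounds [u_n x] below by a hitting
    probability.  The same bound and (ii) give [u > 0] everywhere, and
    [w = ln (u / sup u)]. *)

(** * Extension of a probability space by a random variable with a prescribed conditional law *)

Section extension.
Local Open Scope ereal_scope.
Context d d' (Om : measurableType d) (S : measurableType d') (R : realType).
Variables (Pr : probability Om R) (kap : Om -> probability S R).
Hypothesis mkap : forall A, measurable A -> measurable_fun setT (kap ^~ A).

Let kapm : Om -> {measure set S -> \bar R} := fun w => kap w.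

HB.instance Definition _ := isKernel.Build _ _ _ _ _ kapm mkap.

Let kapm1 w : kapm w setT = 1. Proof. exact: probability_setT. Qed.

HB.instance Definition _ := Kernel_isProbability.Build _ _ _ _ _ kapm kapm1.

Let pair_at (w : Om) (y : S) := (w, y).

HB.instance Definition _ w :=
  @isMeasurableFun.Build _ _ _ _ (pair_at w) (measurable_pair1 w).

(** The law of [(w, y)] with [y] drawn from [kap w]. The [unit] factor arises because [Pr] is viewed
    as a kernel from a one-point space, and composition passes the source point on to the second
    kernel. *)
Let k (x : unit * Om) : {measure set (Om * S) -> \bar R} :=
  distribution (kap x.2) (pair_at x.2).

Let kE x A : k x A = kap x.2 (xsection A x.2).
Proof. by rewrite xsectionE. Qed.

Let mk A : measurable A -> measurable_fun setT (k ^~ A).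
Proof.
move=> mA; under eq_fun do rewrite kE.
apply: (@measurableT_comp _ _ _ _ _ _ (fun w => kap w (xsection A w)) _ snd) => //.
by apply: (measurable_fun_xsection_finite_kernel kapm); rewrite inE.
Qed.

HB.instance Definition _ := isKernel.Build _ _ _ _ _ k mk.

Let k1 x : k x setT = 1. Proof. exact: probability_setT. Qed.

HB.instance Definition _ := Kernel_isProbability.Build _ _ _ _ _ k k1.

Let l : unit -> {measure set Om -> \bar R} :=
  kprobability (@measurable_cst _ _ unit (pprobability Om R) setT Pr).

HB.instance Definition _ := ProbabilityKernel.on l.

Let Q : {measure set (Om * S) -> \bar R} := (l \; k) tt.

Let Q1 : Q setT = 1.
Proof.
rewrite /Q/= /kcomp (eq_integral (cst 1)); last by move=> w _; rewrite k1.
by rewrite integral_cst// mul1e; exact: (probability_setT Pr).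
Qed.

HB.instance Definition _ :=
  Measure_isProbability.Build _ _ _ (kcomp l k tt) Q1.

(** [Q] is [Pr] composed with [k]: first draw [w], then [y] from [kap w]. One such extension adds
    one time step to a controlled chain. *)
Lemma probability_extension : exists Q : probability (Om * S)%type R,
  forall f, (forall z, 0 <= f z) -> measurable_fun setT f ->
    \int[Q]_z f z = \int[Pr]_w \int[kap w]_y f (w, y).
Proof.
exists (kcomp l k tt) => f f0 mf; rewrite integral_kcomp//; apply: eq_integral => w _.
by rewrite /k/= ge0_integral_distribution.
Qed.

End extension.

(** * Controlled chains driven by a Markov feedback *)

Lemma in_preimage T1 T2 (f : T1 -> T2) (A : set T2) x :
  (x \in f @^-1` A) = (f x \in A).
Proof. by apply/idP/idP; rewrite !inE. Qed.

Section chain.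
Local Open Scope ereal_scope.
Context (R : realType) (E U : pmetricType R) (P : E -> U -> probability (borel E) R).
Variables (B : set (borel E)) (mB : measurable B).
Variables (f : borel E -> borel U) (mf : measurable_fun setT f).
Hypothesis mP : forall A : set (borel E), measurable A ->
  measurable_fun (setT : set (borel E)) (fun y : borel E => P y (f y) A).
Variables (v : borel E -> R) (mv : measurable_fun setT v).
Hypothesis v0 : forall y, (0 <= v y)%R.
Variables (K del : R) (K0 : (0 <= K)%R) (del0 : (0 <= del)%R).
Hypothesis v_super : forall y, B y ->
  K%:E * \int[P y (f y)]_(z in B) (v z)%:E <= (v y + del)%:E.

(* Under the Markov feedback [f] the chain is built by adjoining one coordinate at
   a time.  The second conjunct is the supermartingale estimate obtained by
   iterating [v_super], each step costing an error [del]. *)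
Lemma feedback_process (x : E) (Bx : B x) (m : nat) :
  exists (d : measure_display) (Om : measurableType d)
      (Pr : probability Om R) (F : nat -> set (set Om)) (X : nat -> Om -> borel E),
    controlled_process P x m Pr F X (fun i => f \o X i) /\
    (K ^+ m)%:E * \int[Pr]_(w in [set w | forall i, (1 <= i <= m)%N -> B (X i w)])
      (v (X m w))%:E <= (v x + del * \sum_(i < m) K ^+ i)%:E.
Proof.
elim: m => [|m [d [Om [Pr [F [X [[Fs Ff Fm Xx XF aF tr] le]]]]]]].
  (* For [m = 0] a one-point space suffices: the chain sits at [x], the event is the whole space and
     the error sum is empty. *)
  exists _, unit, (dirac tt : probability _ R), (fun=> measurable), (fun _ _ => x).
  split; first by split.
  rewrite expr0 mul1e big_ord0 mulr0 addr0.
  rewrite [X in \int[_]_(_ in X) _](_ : _ = setT); last first.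
    by apply/seteqP; split=> // w _ i /=; case: i.
  rewrite integral_cst//.
  by rewrite [X in _ * X](probability_setT (dirac tt : probability _ R)) mule1.
have mX i : (i <= m)%N -> measurable_fun setT (X i).
  by move=> im _ D mD; rewrite setTI; apply: (Fm i); exact: XF.
pose kap w := P (X m w) (f (X m w)).
have mkap A : measurable A -> measurable_fun setT (kap ^~ A).
  by move=> mA; exact: (measurableT_comp (mP mA) (mX _ (leqnn m))).
have [Q QE] := probability_extension Pr mkap.
(* [Qfst] says that [Q] has first marginal [Pr]; [Qsnd] below says that, given [w], the new
   coordinate has law [kap w]. *)
have Qfst (G : set Om) (h : Om -> \bar R) : measurable G ->
    measurable_fun setT h -> (forall w, 0 <= h w) ->
    \int[Q]_(z in fst @^-1` G) h z.1 = \int[Pr]_(w in G) h w.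
  move=> mG mh h0.
  rewrite integral_mkcond QE; last 2 first.
    by move=> z; exact: erestrict_ge0.
    apply/(measurable_restrictT _ _).1 => //.
      by rewrite -[X in measurable X]setTI; exact: measurable_fst.
    by apply: measurable_funTS; exact: measurableT_comp.
  rewrite [RHS]integral_mkcond; apply: eq_integral => w _.
  rewrite (eq_integral (cst ((h \_ G) w))); last by move=> y _; rewrite /patch/=.
  transitivity ((h \_ G) w * kap w setT); first exact: integral_cst.
  by rewrite probability_setT mule1.
have Qsnd (G : set Om) (h : borel E -> \bar R) : measurable G ->
    measurable_fun setT h -> (forall w, 0 <= h w) ->
    \int[Q]_(z in fst @^-1` G) h z.2 = \int[Pr]_(w in G) \int[kap w]_y h y.
  move=> mG mh h0.
  rewrite integral_mkcond QE; last 2 first.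
    by move=> z; exact: erestrict_ge0.
    apply/(measurable_restrictT _ _).1 => //.
      by rewrite -[X in measurable X]setTI; exact: measurable_fst.
    by apply: measurable_funTS; exact: measurableT_comp.
  rewrite [RHS]integral_mkcond; apply: eq_integral => w _.
  rewrite /patch/=; case: ifPn => wG.
    by apply: eq_integral => y _; rewrite in_preimage wG.
  by rewrite integral0_eq// => y _; rewrite in_preimage (negbTE wG).
pose G := [set w | forall i, (1 <= i <= m)%N -> B (X i w)].
have mG : measurable G.
  rewrite (_ : G = \bigcap_(i in [set i | (1 <= i <= m)%N]) X i @^-1` B)//.
  apply: bigcap_measurableType => // i /= /andP[_ im].
  by rewrite -[X in measurable X]setTI; exact: mX.
(* Times up to [m] are lifted from [Om] along [fst], with the pulled-back filtration; the new
   coordinate serves as the state from time [m.+1] on, with the full sigma-field. *)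
pose X' i (z : Om * borel E) := if (i <= m)%N then X i z.1 else z.2.
pose F' i : set (set (Om * borel E)) :=
  if (i <= m)%N then preimage_set_system setT fst (F i) else measurable.
have X'l i : (i <= m)%N -> X' i = X i \o fst.
  by move=> im; apply/funext => z; rewrite /X' im.
have X'r : X' m.+1 = snd by apply/funext => z; rewrite /X' ltnn.
have F'P i D : (i <= m)%N -> F i D -> F' i (fst @^-1` D).
  by move=> im FD; rewrite /F' im; exists D => //; rewrite setTI.
have mfst (A : set Om) :
    measurable A -> measurable (fst @^-1` A : set (Om * borel E)).
  by move=> mA; rewrite -[X in measurable X]setTI; exact: measurable_fst.
have msnd (A : set (borel E)) :
    measurable A -> measurable (snd @^-1` A : set (Om * borel E)).
  by move=> mA; rewrite -[X in measurable X]setTI; exact: measurable_snd.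
have QfstE (A : set Om) : measurable A -> Q (fst @^-1` A) = Pr A.
  move=> mA; have := Qfst A (cst 1) mA; rewrite !integral_cst//; last exact: mfst.
  by rewrite !mul1e; apply.
have QsndE (A : set Om) (D : set (borel E)) : measurable A -> measurable D ->
    Q (fst @^-1` A `&` snd @^-1` D) = \int[Pr]_(w in A) kap w D.
  move=> mA mD; have := Qsnd A (fun y => (\1_D y)%:E) mA.
  rewrite (_ : (fun _ => _) = fun z : Om * borel E => (\1_(snd @^-1` D) z)%:E)//.
  rewrite integral_indic//; last 2 first.
    exact: mfst.
    exact: msnd.
  rewrite setIC => ->//.
  - by apply: eq_integral => w _; rewrite integral_indic// setIT.
  - by apply/measurable_EFinP.
have F'm i : F' i `<=` measurable.
  rewrite /F'; case: ifP => [_ A' [A FA <-]|_ A' //].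
  by rewrite setTI; apply: mfst; exact: Fm FA.
exists _, _, Q, F', X'; split.
  split.
  - move=> i; rewrite /F'; case: ifP => im; first exact: sigma_algebra_preimage.
    exact: sigma_algebra_measurable.
  - move=> i A FA; rewrite {1}/F'; case: ifPn => im; last exact: (F'm i).
    move: FA; rewrite /F' (ltnW im) => -[D FD <-].
    by exists D => //; exact: Ff.
  - exact: F'm.
  - by move=> z; rewrite X'l//=.
  - move=> i; rewrite leq_eqVlt => /predU1P[->|]; last first.
      rewrite ltnS => im D mD; rewrite X'l//; apply: (F'P _ (X i @^-1` D)) => //; exact: XF.
    by move=> D mD; rewrite /F' ltnn X'r; exact: msnd.
  - move=> i; rewrite ltnS => im D mD; rewrite X'l//.
    apply: (F'P _ ((f \o X i) @^-1` D)) => //.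
    apply: (XF _ im (f @^-1` D)).
    by rewrite -[X in measurable X]setTI; exact: mf.
  - move=> i; rewrite ltnS => im A D FA mD.
    move: FA; rewrite /F' im => -[A' FA' <-]; rewrite setTI.
    have mA' : measurable A' by exact: (Fm i).
    rewrite [RHS](_ : _ = \int[Pr]_(w in A') P (X i w) (f (X i w)) D); last first.
      rewrite -Qfst//; first by rewrite X'l.
      exact: (measurableT_comp (mP mD) (mX _ im)).
    (* At time [m] the transition identity is the construction of [Q]; before [m] it is inherited
       through the first marginal. *)
    move: im; rewrite leq_eqVlt => /predU1P[->|im].
      by rewrite X'r QsndE.
    rewrite X'l// -(tr i)// -QfstE//; apply: measurableI => //.
    by rewrite -[X in measurable X]setTI; exact: mX.
rewrite X'r [X in \int[_]_(_ in X) _](_ : _ = fst @^-1` G `&` snd @^-1` B); last first.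
  apply/seteqP; split => [z zX|z [zG zB] i].
    split; last by have := zX m.+1; rewrite X'r; apply; rewrite leqnn.
    move=> i /andP[i0 im]; have := zX i; rewrite X'l//; apply.
    by rewrite i0 ltnW.
  rewrite [X in _ && X]leq_eqVlt => /andP[i0 /predU1P[->|im]]; first by rewrite X'r.
  by rewrite X'l//; apply: zG; rewrite i0.
rewrite integral_mkcondr.
have mvB : measurable_fun setT ((fun y : borel E => (v y)%:E) \_ B).
  apply/(measurable_restrictT _ _).1 => //; apply: measurable_funTS.
  exact/measurable_EFinP.
rewrite (_ : _ \_ _ = ((fun y => (v y)%:E) \_ B) \o snd); last first.
  by apply/funext => z /=; rewrite /patch in_preimage.
have vB0 y : 0 <= ((fun y : borel E => (v y)%:E) \_ B) y.
  by apply: erestrict_ge0 => z; rewrite lee_fin.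
rewrite Qsnd//.
(* The last coordinate is integrated out first: [v_super] at the state [X m w] trades one factor [K]
   for an error [del]. *)
apply: (@le_trans _ _ ((K ^+ m)%:E * \int[Pr]_(w in G) (v (X m w) + del)%:E)).
  rewrite exprSr EFinM -muleA; apply: lee_wpmul2l; first by rewrite lee_fin exprn_ge0.
  have mkv : measurable_fun setT
      (fun w => \int[kap w]_y ((fun y : borel E => (v y)%:E) \_ B) y).
    exact: (measurable_fun_integral_kernel mkap).
  rewrite -ge0_integralZl//; last 2 first.
    exact: measurable_funTS.
    by move=> w _; exact: integral_ge0.
  apply: ge0_le_integral => //.
  - by move=> w _; rewrite mule_ge0 ?lee_fin//; exact: integral_ge0.
  - by apply: measurable_funTS; exact: measurable_funeM.
  - apply: measurable_funTS; apply/measurable_EFinP; apply: measurable_funD => //.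
    exact: (measurableT_comp mv (mX _ (leqnn m))).
  - move=> w Gw; rewrite -integral_mkcond; apply: v_super.
    (* [G] constrains times 1 to [m] only, so at [m = 0] membership in [B] must come from the
       starting point. *)
    have [->|m0] := posnP m; first by rewrite Xx.
    by apply: Gw; rewrite m0 leqnn.
under eq_integral do rewrite EFinD.
have mvX : measurable_fun setT (v \o X m) by exact: (measurableT_comp mv (mX _ (leqnn m))).
rewrite ge0_integralD//; last 2 first.
  by move=> w _; rewrite lee_fin.
  by apply: measurable_funTS; exact/measurable_EFinP.
rewrite integral_cst// ge0_muleDr; last 2 first.
  by apply: integral_ge0 => w _; rewrite lee_fin.
  by rewrite mule_ge0 ?lee_fin.
rewrite big_ord_recr/= mulrDr addrA [leRHS]EFinD; apply: leeD => //.
rewrite mulrC EFinM; apply: lee_wpmul2l; first by rewrite lee_fin exprn_ge0.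
rewrite -[leRHS]mule1; apply: lee_wpmul2l; first by rewrite lee_fin.
exact: probability_le1.
Qed.

End chain.

(** * Integrals of functions with values in [0, 1], and their dependence on the measure in
    variation *)

Definition unit_fun d (T : measurableType d) (R : realType) (f : T -> R) :=
  measurable_fun setT f /\ forall y, 0 <= f y <= 1.

Section unit_fun.
Context d (T : measurableType d) (R : realType).
Implicit Types (mu : probability T R) (f g : T -> R).

Lemma unit_fun_integrable mu f : unit_fun f -> mu.-integrable setT (EFin \o f).
Proof.
move=> [mf f01]; apply: measurable_bounded_integrable => //.
  by rewrite (le_lt_trans (probability_le1 _ _)) ?ltry.
exists 1; split => // M M1 y _ /=; have /andP[f0 f1] := f01 y.
by rewrite ger0_norm// (le_trans f1)// ltW.
Qed.

Lemma unit_fun_integralE mu f : unit_fun f ->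
  (\int[mu]_y (f y)%:E)%E = (\int[mu]_y f y)%:E.
Proof.
move=> uf; rewrite /Rintegral fineK//.
by apply: integrable_fin_num => //; exact: unit_fun_integrable.
Qed.

Lemma unit_fun_Rintegral_le mu f g : unit_fun f -> unit_fun g ->
  (forall y, f y <= g y) -> \int[mu]_y f y <= \int[mu]_y g y.
Proof.
by move=> uf ug fg; apply: le_Rintegral => // ; exact: unit_fun_integrable.
Qed.

Lemma Rintegral_prob_cst mu r : \int[mu]_y r = r.
Proof.
transitivity (r * fine (mu setT)); first exact: Rintegral_cst.
by rewrite probability_setT mulr1.
Qed.

Lemma unit_fun_indic (A : set T) : measurable A -> unit_fun (\1_A : T -> R).
Proof.
by move=> mA; split => // y; rewrite indicE; case: (_ \in _); rewrite ?lexx ?ler01.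
Qed.

Lemma unit_fun_Rintegral01 mu f : unit_fun f -> 0 <= \int[mu]_y f y <= 1.
Proof.
move=> uf; have [mf f01] := uf; apply/andP; split.
  by apply: Rintegral_ge0 => y _; have /andP[] := f01 y.
rewrite -[leRHS](Rintegral_prob_cst mu); apply: le_Rintegral => //.
- exact: unit_fun_integrable.
- by apply: unit_fun_integrable; split => // y; rewrite ler01 lexx.
- by move=> y _; have /andP[] := f01 y.
Qed.

(** Pointwise, the difference is at most [e] plus the indicator of the complement of [A], because
    two values in [0, 1] never differ by more than 1. *)
Lemma unit_fun_Rintegral_dist mu f g (e : R) (A : set T) : measurable A ->
  unit_fun f -> unit_fun g -> 0 <= e ->
  (forall y, A y -> `|f y - g y| <= e) ->
  `|\int[mu]_y f y - \int[mu]_y g y| <= e + fine (mu (~` A)).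
Proof.
move=> mA uf ug e0 fge.
have iu := @unit_fun_integrable mu.
rewrite -RintegralB//; [|exact: iu..].
have ifg : mu.-integrable setT (EFin \o (fun y => f y - g y)).
  rewrite (_ : _ \o _ = (EFin \o f) \- (EFin \o g))%E//.
  by apply: integrableB => //; exact: iu.
apply: (le_trans (le_normr_Rintegral _ ifg)) => //.
rewrite -[leRHS](_ : \int[mu]_y (e + \1_(~` A) y) = _); last first.
  rewrite RintegralD//; last 2 first.
  - rewrite (_ : _ \o _ = cst e%:E)//; exact: finite_measure_integrable_cst.
  - by apply: iu; apply: unit_fun_indic; exact: measurableC.
  by rewrite Rintegral_prob_cst /Rintegral integral_indic ?setIT//; exact: measurableC.
apply: le_Rintegral => //.
- exact: integrable_norm.
- rewrite (_ : _ \o _ = cst e%:E \+ (EFin \o \1_(~` A)))%E//; apply: integrableD => //.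
    exact: finite_measure_integrable_cst.
  by apply: iu; apply: unit_fun_indic; exact: measurableC.
- move=> y _; rewrite indicE; have [Ay|Ay] := pselect (A y).
    by rewrite (le_trans (fge y Ay))// lerDl.
  rewrite mem_set//=; have [_ f01] := uf; have [_ g01] := ug.
  have := f01 y; have := g01 y => /andP[? ?] /andP[? ?].
  by rewrite ler_norml; apply/andP; split; lra.
Qed.

End unit_fun.

(* [C] is the integer part of [v] truncated at [n]. *)
Lemma count_levels (R : realType) (v : R) (n : nat) : 0 <= v ->
  let C := \sum_(j < n) (j.+1%:R <= v)%R%:R in
  [/\ C <= v, C <= n%:R & v - 1 <= C \/ n%:R <= C].
Proof.
move=> v0; elim: n => [|n [IH1 IH2 IH3]] /=; first by rewrite big_ord0; split=> //; right.
rewrite big_ord_recr/=; set C := \sum_(j < n) _ in IH1 IH2 IH3 *.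
have E : n.+1%:R = n%:R + 1 :> R by rewrite -natr1.
by case: (leP n.+1%:R v) => /= nv; rewrite ?addr0; rewrite E in nv *;
  split; try lra; case: IH3; try (left; lra); try (right; lra); left; lra.
Qed.

Section variation.
Context d (T : measurableType d) (R : realType).
Implicit Types (mu nu : probability T R) (f : T -> R).

Lemma unit_fun_variation mu nu f (eta : R) : unit_fun f ->
  (forall A, measurable A -> `|fine (mu A) - fine (nu A)| <= eta) ->
  `|\int[mu]_y f y - \int[nu]_y f y| <= eta.
Proof.
(* [f] is approximated within [1/N] by the average [g] of the indicators of its
   level sets [A j], whose integrals differ by at most [eta]. *)
move=> uf H; apply/ler_addgt0Pr => e e0; have [mf f01] := uf.
(* Replacing [f] by [g] costs [1/N] under each of the two measures, hence the factor 2. *)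
have [N N0 Ne] : exists2 N : nat, (0 < N)%N & 2 * N%:R^-1 <= e.
  exists (Num.truncn (2 / e)).+1 => //.
  rewrite ler_pdivrMr ?ltr0Sn// mulrC -ler_pdivrMr//; apply: ltW.
  by have /andP[] := truncn_itv (ltW (divr_gt0 (ltr0Sn R 1) e0)).
have N0' : 0 < N%:R :> R by rewrite ltr0n.
pose A j := [set y | j.+1%:R <= N%:R * f y].
have mA j : measurable (A j).
  rewrite -[A j]setTI.
  rewrite (_ : A j = (fun y => N%:R * f y) @^-1` `[j.+1%:R, +oo[%classic).
    by apply: measurable_funM => //; exact: measurable_itv.
  by apply/seteqP; split => y /=; rewrite in_itv/= andbT.
pose g y := N%:R^-1 * \sum_(j < N) \1_(A j) y : R.
have gE y : g y = N%:R^-1 * \sum_(j < N) (j.+1%:R <= N%:R * f y)%R%:R.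
  congr (_ * _); apply: eq_bigr => j _; rewrite indicE; congr ((nat_of_bool _)%:R).
  by apply/idP/idP; rewrite inE.
have gf y : g y <= f y <= g y + N%:R^-1.
  have /andP[f0 f1] := f01 y.
  have [C1 C2 C3] := count_levels N (mulr_ge0 (ltW N0') f0).
  rewrite gE; set C := \sum_(_ < _) _ in C1 C2 C3 *.
  have -> : N%:R^-1 * C + N%:R^-1 = N%:R^-1 * (C + 1) by rewrite mulrDr mulr1.
  rewrite ler_pdivrMl// ler_pdivlMl// C1/=.
  (* In the truncated case [N <= C] the upper bound follows from [f y <= 1]. *)
  have : N%:R * f y <= N%:R by rewrite ler_piMr// ltW.
  by case: C3 => C3 fN; lra.
have ug : unit_fun g.
  split.
    apply: measurable_funM => //; apply: measurable_sum => j.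
    exact: measurable_indic.
  move=> y; have /andP[f0 f1] := f01 y; have /andP[g1 g2] := gf y.
  by rewrite (le_trans g1 f1) andbT gE mulr_ge0 ?invr_ge0 ?ler0n// sumr_ge0//.
have iu (m : probability T R) := @unit_fun_integrable _ _ _ m.
have gint (m : probability T R) : \int[m]_y g y = N%:R^-1 * \sum_(j < N) fine (m (A j)).
  rewrite /g RintegralZl//; last first.
    rewrite (_ : _ \o _ = (fun y => \sum_(j < N) (\1_(A j) y)%:E)%E).
      by apply: integrable_sum => // j _; apply: iu; exact: unit_fun_indic.
    by apply/funext => y /=; rewrite sumEFin.
  congr (_ * _); rewrite /Rintegral.
  under eq_integral do rewrite -sumEFin.
  rewrite integral_sum//; last first.
    by move=> j; apply: iu; exact: unit_fun_indic.
  under eq_bigr do rewrite integral_indic// setIT.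
  rewrite -[RHS]/(fine (\sum_(j < N) fine (m (A j)))%:E) -sumEFin.
  by congr fine; apply: eq_bigr => j _; rewrite fineK// fin_num_measure.
have fg (m : probability T R) : `|\int[m]_y f y - \int[m]_y g y| <= N%:R^-1.
  have := @unit_fun_Rintegral_dist _ _ _ m f g N%:R^-1 setT measurableT uf ug.
  rewrite setCT measure0 addr0; apply; first by rewrite invr_ge0 ler0n.
  move=> y _; have /andP[g1 g2] := gf y; rewrite ler_norml; apply/andP; split; lra.
have gg : `|\int[mu]_y g y - \int[nu]_y g y| <= eta.
  rewrite !gint -mulrBr normrM ger0_norm ?invr_ge0// ler_pdivrMl//.
  rewrite -sumrB (le_trans (ler_norm_sum _ _ _))//.
  rewrite -[N in leRHS]card_ord -sum1_card natr_sum mulr_suml.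
  by apply: ler_sum => j _; rewrite mul1r; exact: H.
have := fg mu; have := fg nu; move: gg Ne; rewrite !ler_norml.
by move=> /andP[? ?] ? /andP[? ?] /andP[? ?]; apply/andP; split; lra.
Qed.

End variation.

(** * Neighbourhood forms of continuity in variation, uniform in the control *)

Lemma cvg_ball_harmonic (R : realType) (M : pmetricType R) (x : M) (x_ : nat -> M) :
  (forall k, ball x k.+1%:R^-1 (x_ k)) -> x_ k @[k --> \oo] --> x.
Proof.
move=> H; apply/cvg_ballP => e e0; near=> k.
apply: le_ball (H k); apply: ltW; near: k; exact: near_infty_natSinv_lt (PosNum e0).
Unshelve. all: end_near. Qed.

Definition variation_continuous (R : realType) (E U : pmetricType R)
    (P : E -> U -> probability (borel E) R) : Prop :=
  forall (x_ : nat -> E) (a_ : nat -> U) (x : E) (a : U),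
    x_ k @[k --> \oo] --> x -> a_ k @[k --> \oo] --> a ->
    ereal_sup [set `|P (x_ k) (a_ k) A - P x a A|%E
              | A in (measurable : set (set (borel E)))] @[k --> \oo]
      --> (0 : R)%:E.

Section variation_continuity.
Context (R : realType) (E U : pmetricType R) (P : E -> U -> probability (borel E) R).
Hypothesis P_variation_continuous : variation_continuous P.

(** Counterexamples within [1/(k+1)] of [x] and [a] would form convergent sequences violating the
    sequential hypothesis. *)
Lemma variation_near x a (eta : R) : 0 < eta ->
  \forall x' \near x & a' \near a, forall A : set (borel E), measurable A ->
    `|fine (P x' a' A) - fine (P x a A)| <= eta.
Proof.
move=> eta0; apply: contrapT => nH.
have /choice[xa xaP] : forall k : nat, exists xa : E * U,
    [/\ ball x k.+1%:R^-1 xa.1, ball a k.+1%:R^-1 xa.2 &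
     exists2 A : set (borel E), measurable A &
       eta < `|fine (P xa.1 xa.2 A) - fine (P x a A)|].
  move=> k; apply: contrapT => nk; apply: nH.
  exists (ball x k.+1%:R^-1, ball a k.+1%:R^-1) => /=.
    by split; apply: nbhsx_ballx; rewrite invr_gt0.
  move=> [x' a'] /= [bx ba] A mA; rewrite leNgt; apply/negP => lt.
  by apply: nk; exists (x', a'); split => //; exists A.
have cx : (xa k).1 @[k --> \oo] --> x.
  by apply: cvg_ball_harmonic => k; have [] := xaP k.
have ca : (xa k).2 @[k --> \oo] --> a.
  by apply: cvg_ball_harmonic => k; have [] := xaP k.
have /(_ [set y | (y < eta%:E)%E]) := P_variation_continuous cx ca.
have : nbhs (0%:E : \bar R) [set y | (y < eta%:E)%E].
  by apply: open_nbhs_nbhs; split; [exact: open_ereal_lt_ereal|rewrite /= lte_fin].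
move=> /[swap] /[apply] -[N _ /(_ N (leqnn N))] /=; apply/negP; rewrite -leNgt.
have [_ _ [A mA /ltW lt]] := xaP N.
apply: le_trans; last by apply: ereal_sup_ubound; exists A => //; reflexivity.
have fin (p : probability (borel E) R) : p A = (fine (p A))%:E.
  by rewrite fineK// fin_num_measure.
by rewrite (fin (P (xa N).1 (xa N).2)) (fin (P x a)) -EFinB abse_EFin lee_fin.
Qed.

Lemma Rintegral_near x a (eta : R) : 0 < eta ->
  \forall x' \near x & a' \near a, forall f : borel E -> R, unit_fun f ->
    `|\int[P x' a']_y f y - \int[P x a]_y f y| <= eta.
Proof.
move=> eta0; apply: filterS (variation_near x a eta0) => -[x' a'] /= H f uf.
exact: unit_fun_variation.
Qed.

Hypothesis U_compact : compact [set: U].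

(** For [a'] near [a], the laws at [(x', a')] and [(x, a')] are both [eta / 2]-close to the one at
    [(x, a)]; compactness of [U] then gives one neighbourhood of [x] for all controls. *)
Lemma Rintegral_near_unif x (eta : R) : 0 < eta ->
  \forall x' \near x, forall a, forall f : borel E -> R, unit_fun f ->
    `|\int[P x' a]_y f y - \int[P x a]_y f y| <= eta.
Proof.
move=> eta0; have eta2 : 0 < eta / 2 by rewrite divr_gt0.
have /compact_near_coveringP C := U_compact.
apply: filterS (C E (nbhs x) (fun x' a => forall f : borel E -> R, unit_fun f ->
    `|\int[P x' a]_y f y - \int[P x a]_y f y| <= eta) _ _).
  by move=> x' H a; exact: H.
move=> a _; have [[V W] /= [xV aW] VW] := Rintegral_near x a eta2.
exists (W, V) => //= -[a' x'] /= [Wa' Vx'] f uf.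
have := VW (x', a') (conj Vx' Wa') f uf.
have := VW (x, a') (conj (nbhs_singleton xV) Wa') f uf.
rewrite /= !ler_norml => /andP[? ?] /andP[? ?].
by apply/andP; split; lra.
Qed.

Variable b : E.

(** A single law has vanishing tails since the balls exhaust [E]; continuity in variation carries
    the bound to nearby controls, and compactness of [U] to all of them. *)
Lemma tight_near x (eta : R) : 0 < eta ->
  \forall k \near \oo, forall a, fine (P x a (~` Bn b k)) <= eta.
Proof.
move=> eta0; have eta2 : 0 < eta / 2 by rewrite divr_gt0.
have mC k : measurable (~` Bn b k : set (borel E)).
  by apply: measurableC; exact: measurable_Bn.
have dec k l : (k <= l)%N -> ~` Bn b l `<=` ~` Bn b k.
  by move=> kl y; apply: contra_not => /le_trans; apply; rewrite ler_nat.
have /compact_near_coveringP C := U_compact.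
apply: filterS (C nat \oo (fun k a => fine (P x a (~` Bn b k)) <= eta) _ _).
  by move=> k H a; exact: H.
move=> a _; have [[V W] /= [xV aW] VW] := variation_near x a eta2.
have : P x a (~` Bn b k) @[k --> \oo] --> P x a (\bigcap_k ~` Bn b k).
  apply: nonincreasing_cvg_mu => //.
  - by rewrite (le_lt_trans (probability_le1 _ _)) ?ltry.
  - exact: bigcap_measurable.
  - by move=> k l kl; apply/subsetPset; exact: dec.
rewrite (_ : \bigcap_k _ = set0); last first.
  apply/seteqP; split => // y /(_ (Num.truncn (mdist b y)).+1 I); apply => /=.
  by apply: ltW; have /andP[] := truncn_itv (mdist_ge0 b y).
rewrite measure0 => /fine_cvg /cvgr_lt/(_ _ eta2) H.
exists (W, [set k | fine (P x a (~` Bn b k)) < eta / 2]) => //= -[a' k] /= [Wa' Hk].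
have := VW (x, a') (conj (nbhs_singleton xV) Wa') _ (mC k).
by rewrite /= ler_norml => /andP[? ?]; lra.
Qed.

End variation_continuity.

(** * Near-optimal feedbacks and lower bounds by hitting probabilities *)

Lemma continuous_borel_measurable (R : realType) (T : ptopologicalType) (f : T -> R) :
  continuous f -> measurable_fun (setT : set (borel T)) f.
Proof.
move=> cf; apply: (measurability _ (RGenOpens.measurableE R)) => _ [_ [a [c ->]] <-].
rewrite setTI; apply: sub_sigma_algebra.
by apply: open_comp; [move=> + _; exact: cf|exact: interval_open].
Qed.

Section reach.
Context (R : realType) (E U : pmetricType R) (P : E -> U -> probability (borel E) R).
Hypothesis P_variation_continuous : variation_continuous P.

Lemma measurable_transition a (A : set (borel E)) : measurable A ->
  measurable_fun (setT : set (borel E)) (fun y : borel E => P y a A).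
Proof.
move=> mA; rewrite (_ : (fun _ => _) = EFin \o (fun y => fine (P y a A))); last first.
  by apply/funext => y /=; rewrite fineK// fin_num_measure.
apply/measurable_EFinP; apply: continuous_borel_measurable => y.
apply/cvgrPdist_le => e e0.
have [[V W] /= [yV aW] VW] := variation_near P_variation_continuous y a e0.
apply: filterS yV => y' Vy'; rewrite distrC.
exact: (VW (y', a) (conj Vy' (nbhs_singleton aW))).
Qed.

Variables (B : set (borel E)) (B_compact : compact (B : set E)) (mB : measurable B).
Variables (v : E -> R) (v_continuous : continuous v) (v0 : forall y, 0 <= v y).
Hypothesis v_unit : unit_fun (v \_ B : borel E -> R).
Variables (K : R) (K0 : 0 <= K).
Hypothesis v_super : forall y, B y -> forall e, 0 < e ->
  exists a, K * \int[P y a]_z (v \_ B) z <= v y + e.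

Lemma measurable_feedback (del : R) : 0 < del ->
  exists f : borel E -> borel U, [/\ measurable_fun setT f,
    forall A : set (borel E), measurable A ->
      measurable_fun (setT : set (borel E)) (fun y : borel E => P y (f y) A) &
    forall y, B y -> K * \int[P y (f y)]_z (v \_ B) z <= v y + del].
Proof.
(* By continuity in variation a near-optimal control at [y] stays near-optimal on
   a neighbourhood [V y]; finitely many of them cover [B], so a finite-valued [f]
   suffices and no measurable selection theorem is needed. *)
move=> del0.
pose ok (D : set E) := exists f : borel E -> borel U, [/\ measurable_fun setT f,
    forall A : set (borel E), measurable A ->
      measurable_fun (setT : set (borel E)) (fun y : borel E => P y (f y) A) &
    forall y, D y -> K * \int[P y (f y)]_z (v \_ B) z <= v y + del].
have /choice[a aP] : forall y, exists a,
    B y -> K * \int[P y a]_z (v \_ B) z <= v y + del / 4.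
  move=> y; have [By|nBy] := pselect (B y); last by exists point.
  by have [|a Ha] := v_super By (e := del / 4); [rewrite divr_gt0|exists a].
pose V y : set (borel E) :=
  interior [set y' | K * \int[P y' (a y)]_z (v \_ B) z <= v y' + del].
have mV y : measurable (V y : set (borel E)).
  by apply: sub_sigma_algebra; exact: open_interior.
have BV y : B y -> V y y.
  move=> By; rewrite /V/= /interior/=.
  (* [K] may be 0, so the tolerance is divided by [K + 1]. The choice of [a y], the change of kernel
     and the change of [v] each cost at most [del / 4]. *)
  have K1 : 0 < K + 1 by rewrite ltr_wpDl.
  have e0 : 0 < del / 4 / (K + 1) by rewrite !divr_gt0.
  have [[V1 W] /= [yV aW] VW] := Rintegral_near P_variation_continuous y (a y) e0.
  have /cvgrPdist_le/(_ (del / 4)) vy := @v_continuous y.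
  near=> y'.
  have Vy' : V1 y' by near: y'; exact: yV.
  have := VW (y', a y) (conj Vy' (nbhs_singleton aW)) _ v_unit.
  have : `|v y - v y'| <= del / 4 by near: y'; apply: vy; rewrite divr_gt0.
  have := aP y By; rewrite /= !ler_norml.
  set I := Rintegral _ _ _; set I' := Rintegral _ _ _.
  move=> h1 /andP[h2 h3] /andP[h4 h5].
  have : K * (I' - I) <= del / 4.
    apply: (@le_trans _ _ (K * (del / 4 / (K + 1)))); first exact: ler_wpM2l.
    rewrite mulrCA ler_piMr ?ler_pdivrMr ?mul1r ?lerDl// divr_ge0// ltW//.
  by rewrite mulrBr; lra.
(* Patching the constant control [a y] onto [f] over the open set [V y] preserves measurability. *)
have okU y D : ok D -> ok (V y `|` D).
  move=> [f [mf mPf fP]]; exists (fun z => if z \in V y then a y else f z).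
  have mVy : measurable_fun (setT : set (borel E)) (fun z : borel E => z \in V y).
    apply: (measurable_fun_bool true); rewrite setTI.
    rewrite (_ : _ @^-1` _ = V y)//.
    by apply/seteqP; split => z; [exact: set_mem|exact: mem_set].
  split.
  - by apply: measurable_fun_ifT.
  - move=> A mA.
    rewrite (_ : (fun _ => _) = fun z => if z \in V y then P z (a y) A else P z (f z) A).
      apply: measurable_fun_ifT => //; [exact: measurable_transition|exact: mPf].
    by apply/funext => z; case: ifP.
  - move=> z; case: ifPn => [|zV [|]].
    + by move=> /set_mem/interior_subset.
    + by move=> /mem_set; rewrite (negbTE zV).
    + exact: fP.
have ok0 : ok set0.
  exists (fun=> point); split => // A mA; exact: measurable_transition.
move: B_compact; rewrite compact_cover => /(_ E B V) [|y By|D _ BD].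
- by move=> y _; exact: open_interior.
- by exists y => //; exact: BV.
have : ok (cover [set` D] V).
  rewrite (_ : cover _ _ = \bigcup_(i in [set` enum_fset D]) V i)//.
  elim: (enum_fset D) => [|y s IH].
    by rewrite (_ : \bigcup_(_ in _) _ = set0)// -subset0 => z [].
  rewrite (_ : \bigcup_(_ in _) _ = V y `|` \bigcup_(i in [set` s]) V i); first exact: okU.
  apply/seteqP; split => z.
    move=> [i /=]; rewrite inE => /predU1P[->|si] Vz; [by left|right; by exists i].
  move=> [Vz|[i si Vz]]; first by exists y => //=; rewrite inE eqxx.
  by exists i => //=; rewrite inE si orbT.
move=> [f [mf mPf fP]]; exists f; split => // y By; apply: fP; exact: BD.
Unshelve. all: end_near. Qed.

(** Iterating the inequality along a near-optimal feedback bounds [v x] below by [K ^+ m] times the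
    integral of [v (X m)] over the paths that stay in [B]. Where the target is hit, [v] exceeds
    [eps], and the infimum over strategies is at most the probability under this feedback. *)
Lemma hitting_le (b : E) (n : nat) (x : E) (m : nat) (eps : R) :
  B = Bn b n -> B x -> 0 <= eps ->
  ((K ^+ m * eps)%:E * inf_hatP b P n m x [set y | eps < v y]%R <= (v x)%:E)%E.
Proof.
move=> BE Bx eps0; apply/lee_addgt0Pr => e e0.
have mv : measurable_fun setT (v : borel E -> R) by exact: continuous_borel_measurable.
(* The total error of the iteration is [del * S]; taking [del = e / (S + 1)] keeps it below [e] even
   when [S = 0]. *)
set S := \sum_(i < m) K ^+ i.
have S0 : 0 <= S by apply: sumr_ge0 => i _; exact: exprn_ge0.
have S1 : 0 < S + 1 by rewrite ltr_wpDl.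
have d0 : 0 < e / (S + 1) by rewrite divr_gt0.
have [f [mf mPf fP]] := measurable_feedback d0.
have fP' (y : borel E) : B y ->
    (K%:E * \int[P y (f y)]_(z in B) (v z)%:E <= (v y + e / (S + 1))%:E)%E.
  move=> By; rewrite integral_mkcond.
  under eq_integral do rewrite restrict_EFin.
  rewrite unit_fun_integralE//.
  by rewrite -EFinM lee_fin; exact: fP.
have [d [Om [Pr [F [X [cp le]]]]]] :=
  feedback_process mB mf mPf mv v0 K0 (ltW d0) fP' Bx m.
apply: (@le_trans _ _ (v x + e / (S + 1) * S)%:E); last first.
  rewrite -EFinD lee_fin lerD2l -mulrAC ler_pdivrMr// ler_wpM2l ?lerDl// ltW//.
apply: le_trans le.
pose G := [set w | forall i, (1 <= i <= m)%N -> B (X i w)].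
rewrite EFinM -muleA; apply: lee_wpmul2l; first by rewrite lee_fin exprn_ge0.
have mX i : (i <= m)%N -> measurable_fun setT (X i).
  move=> im _ D mD; rewrite setTI; apply: (cp_measurable cp (i := i)).
  exact: (cp_state cp).
have mG : measurable G.
  rewrite (_ : G = \bigcap_(i in [set i | (1 <= i <= m)%N]) X i @^-1` B)//.
  apply: bigcap_measurableType => // i /= /andP[_ im].
  by rewrite -[X in measurable X]setTI; exact: mX.
have mvX : measurable_fun setT (v \o X m) by exact: (measurableT_comp mv (mX _ (leqnn m))).
pose H := [set w | eps < v (X m w)].
have mH : measurable H.
  rewrite (_ : H = (v \o X m) @^-1` `]eps, +oo[%classic).
    by rewrite -[X in measurable X]setTI; apply: mvX => //; exact: measurable_itv.
  by apply/seteqP; split => w /=; rewrite in_itv/= andbT.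
apply: (@le_trans _ _ (eps%:E * Pr (G `&` H))%E).
  apply: lee_wpmul2l; first by rewrite lee_fin.
  apply: ereal_inf_lbound; exists d, Om, Pr, F, X, (fun i => f \o X i); split => //.
  by rewrite /G /H BE.
rewrite -integral_cst; last exact: measurableI.
apply: (@le_trans _ _ (\int[Pr]_(w in G `&` H) (v (X m w))%:E)%E).
  apply: ge0_le_integral => //.
  - exact: measurableI.
  - by apply: measurable_funTS; exact/measurable_EFinP.
  - by move=> w [_ Hw]; rewrite lee_fin ltW.
apply: ge0_subset_integral => //; first exact: measurableI.
- by apply: measurable_funTS; exact/measurable_EFinP.
- by move=> w _; rewrite lee_fin.
Qed.

End reach.

(** * The support of the restart law and integration against [tildeP] *)

(** Every point off the support has a null open neighbourhood; by separability, countably many balls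
    of radius [1/(k+1)], centred in a dense sequence and contained in such neighbourhoods, cover the
    complement of [B]. *)
Lemma msupport_null (R : realType) (E : pmetricType R) (mu : probability (borel E) R)
  (B : set (borel E)) : separable E -> measurable B -> msupport mu `<=` B ->
  mu (~` B) = 0%E.
Proof.
move=> [S [cS dS]] mB suppB; apply/negligibleP; first exact: measurableC.
(* The dense set is nonempty, so that it can be enumerated by [nat]. *)
have [x0 [_ Sx0]] := dS setT (ex_intro _ point I) openT.
have [s Ss] : exists s : nat -> E, S `<=` range s.
  have [S0|[s]] := pfcard_geP cS; first by rewrite S0 in Sx0.
  by exists s => y /(@surj _ _ _ _ s)[k _ <-]; exists k.
pose null r y := exists V : set E, [/\ open V, ball y r `<=` V & mu V = 0%E].
pose F k l : set (borel E) := [set y | null k.+1%:R^-1 (s l) /\ ball (s l) k.+1%:R^-1 y].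
apply: (@negligibleS _ _ _ _ (\bigcup_k \bigcup_l F k l)).
  move=> y /= /(contra_not (@suppB y)) /existsNP[V /not_implyP[oV /not_implyP[Vy /negP]]].
  rewrite -leNgt => mV.
  have [e /= e0 eV] : nbhs_ball y V by apply/nbhs_ballP; exact: open_nbhs_nbhs.
  (* A radius below [e / 2] makes the ball about a dense point near [y] fit inside the [e]-ball
     about [y]. *)
  have [k ke] : exists k : nat, k.+1%:R^-1 < e / 2.
    have e2 : 0 < e / 2 by rewrite divr_gt0.
    have [k _ /(_ k (leqnn k))] := near_infty_natSinv_lt (PosNum e2).
    by exists k.
  have [z [/interior_subset yz Sz]] : (ball y k.+1%:R^-1)^° `&` S !=set0.
    apply: dS; last exact: open_interior.
    by exists y; apply: nbhsx_ballx; rewrite invr_gt0.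
  have [l _ lz] := Ss _ Sz.
  exists k => //; exists l => //; rewrite /F /= lz; split; last exact: ball_sym.
  exists V; split => //; last by apply/eqP; rewrite eq_le mV measure_ge0.
  move=> t zt; apply: eV; rewrite [e]splitr.
  by apply: ball_triangle (le_ball (ltW ke) zt); exact: le_ball (ltW ke) _ yz.
apply: negligible_bigcup => k; apply: negligible_bigcup => l.
have [[V [oV sV V0]]|nV] := pselect (null k.+1%:R^-1 (s l)); last first.
  by apply: negligibleS (negligible_set0 _) => y [].
exists V; split => //; first exact: sub_sigma_algebra.
by move=> y [_]; exact: sV.
Qed.

Section tildeP_integral.
Context (R : realType) (E U : pmetricType R) (b : E) (mu : probability (borel E) R).
Variable (P : E -> U -> probability (borel E) R).

Lemma dist_set_ge0 n x : 0 <= dist_set x (Bn b n).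
Proof.
apply: lb_le_inf; last by move=> _ [y _ <-]; exact: mdist_ge0.
by exists (mdist x b), b => //; rewrite /Bn /= mdistxx.
Qed.

Lemma dist_set0 n x : Bn b n x -> dist_set x (Bn b n) = 0.
Proof.
move=> Bx; apply/eqP; rewrite eq_le dist_set_ge0 andbT; apply: ge_inf.
  by exists 0 => _ [y _ <-]; exact: mdist_ge0.
by exists x => //; rewrite mdistxx.
Qed.

Local Open Scope ereal_scope.

(** On [B_n] the distance vanishes: [tildeP] is [P] killed on leaving [B_n], plus a restart with law
    [mu] carrying the lost mass. *)
Lemma tildeP_integral n x a (f : borel E -> \bar R) : Bn b n x ->
  measurable_fun setT f -> (forall y, 0 <= f y) ->
  \int[tildeP b mu P n x a]_y f y =
  \int[P x a]_(y in Bn b n) f y + P x a (~` Bn b n) * \int[mu]_y f y.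
Proof.
move=> Bx mf f0; have mB := measurable_Bn b n.
have mC : measurable (~` Bn b n : set (borel E)) by exact: measurableC.
have k0 : (0 <= fine (P x a (~` Bn b n)))%R by exact: fine_ge0.
rewrite (eq_measure_integral (measure_add (mrestr (P x a) mB) (mscale (NngNum k0) mu))).
  rewrite ge0_integral_measure_add// ge0_integral_mscale//= fineK ?fin_num_measure//.
  congr (_ + _).
  have C0 : mrestr (P x a) mB (~` Bn b n) = 0 by rewrite /mrestr setICl measure0.
  rewrite (ge0_negligible_integral mC)// setTD setCK.
  by apply: eq_measure_integral => A mA AB; rewrite /= /mrestr setIidl.
move=> A mA _; rewrite [RHS]measure_addE/= /tildeP /mrestr /mscale/= dist_set0//.
rewrite subr0 max_r ?ler01// mul1e min_l ?ler01// mul0e adde0.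
by rewrite fineK ?fin_num_measure// muleC.
Qed.

(** [tildeP] is carried by [B_n] because [mu] is, and its mass there is at most 1, also when [x]
    lies outside [B_n]. *)
Lemma tildeP_integral_le1 n x a (f : borel E -> \bar R) : mu (~` Bn b n) = 0 ->
  measurable_fun setT f -> (forall y, 0 <= f y) -> (forall y, Bn b n y -> f y <= 1) ->
  \int[tildeP b mu P n x a]_y f y <= 1.
Proof.
move=> mu0 mf f0 f1; have mB := measurable_Bn b n.
have mC : measurable (~` Bn b n : set (borel E)) by exact: measurableC.
have T0 : tildeP b mu P n x a (~` Bn b n) = 0.
  by rewrite /tildeP mu0 mul0e adde0 setICl measure0 mule0.
rewrite (ge0_negligible_integral mC)// setTD setCK.
apply: (@le_trans _ _ (\int[tildeP b mu P n x a]_(y in Bn b n) cst 1 y)).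
  apply: ge0_le_integral => //; exact: measurable_funTS.
rewrite integral_cst// mul1e; change (tildeP b mu P n x a (Bn b n) <= 1).
rewrite /tildeP setIid.
have := probability_setC (P x a) mB.
have muB : mu (Bn b n) <= 1 by exact: probability_le1.
have fK (p : probability (borel E) R) A : measurable A -> p A = (fine (p A))%:E.
  by move=> mA; rewrite fineK// fin_num_measure.
rewrite (fK (P x a) (Bn b n))// (fK (P x a) (~` Bn b n))// (fK mu (Bn b n))// in muB *.
have := dist_set_ge0 n x; set D := dist_set _ _.
have : (0 <= fine (P x a (Bn b n)))%R by exact: fine_ge0.
have : (0 <= fine (P x a (~` Bn b n)))%R by exact: fine_ge0.
have : (0 <= fine (mu (Bn b n)))%R by exact: fine_ge0.
move: muB; rewrite lee_fin.
set p := fine (P x a (Bn b n)); set q := fine (P x a (~` Bn b n)); set r := fine _.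
move=> r1 r0 q0 p0 D0; rewrite -EFinB => -[qE].
rewrite -EFinB -!EFinM -!EFinD -?EFinM -?EFinD lee_fin.
(* The two cut-off weights add up to 1, so a single parameter [s] describes both. *)
have [s s0 [-> ->]] : exists2 s : R, (0 <= s <= 1)%R &
    (Num.max 0 (1 - D) = s /\ Num.min D 1 = 1 - s)%R.
  case: (leP D 1%R) => D1; [exists (1 - D)%R|exists 0%R];
    first (by lra); rewrite ?lexx ?ler01//.
    by rewrite max_r ?subr_ge0//; split => //; lra.
  by rewrite max_l ?subr_le0 ?ltW//; split => //; lra.
have : (r * (q + (1 - s) * (1 - q)) <= q + (1 - s) * (1 - q))%R.
  by rewrite ler_piMl//; nra.
rewrite qE; nra.
Qed.

End tildeP_integral.

(** * Infima and their stability under uniform perturbation *)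

(** The real-valued epsilon form of an infimum, which interacts directly with uniform estimates;
    [is_infP] identifies it with the extended infimum. *)
Definition is_inf (R : realType) (A : Type) (h : A -> R) (v : R) :=
  (forall a, v <= h a) /\ (forall e, 0 < e -> exists a, h a <= v + e).

Section is_inf.
Context (R : realType) (A : Type).
Implicit Types (h : A -> R) (v : R).

Lemma is_inf_dist h1 h2 v1 v2 eta : is_inf h1 v1 -> is_inf h2 v2 ->
  (forall a, `|h1 a - h2 a| <= eta) -> `|v1 - v2| <= eta.
Proof.
move=> [l1 i1] [l2 i2] H; apply/ler_addgt0Pr => e e0.
have [a1 h1a] := i1 e e0; have [a2 h2a] := i2 e e0.
have := H a1; have := H a2; have := l1 a2; have := l2 a1; rewrite !ler_norml.
by move=> ? ? /andP[? ?] /andP[? ?]; apply/andP; split; lra.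
Qed.

Lemma is_inf_lim h v : (forall eta, 0 < eta -> exists h' v', [/\ is_inf h' v',
  `|v' - v| <= eta & forall a, `|h' a - h a| <= eta]) -> is_inf h v.
Proof.
move=> H; split.
  move=> a; apply/ler_addgt0Pr => e e0.
  have [|h' [v' [[l i] dv dh]]] := H (e / 2); first by rewrite divr_gt0.
  have := dh a; have := l a; move: dv; rewrite !ler_norml.
  by move=> /andP[? ?] ? /andP[? ?]; lra.
move=> e e0; have [|h' [v' [[l i] dv dh]]] := H (e / 3); first by rewrite divr_gt0.
have [|a ha] := i (e / 3); first by rewrite divr_gt0.
exists a; have := dh a; move: dv; rewrite !ler_norml.
by move=> /andP[? ?] /andP[? ?]; lra.
Qed.

Lemma is_infP h v :
  is_inf h v <-> (v%:E = ereal_inf [set (h a)%:E | a in [set: A]])%E.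
Proof.
split=> [[l i]|vE].
  apply/eqP; rewrite eq_le; apply/andP; split.
    by apply: le_ereal_inf_tmp => _ [a _ <-]; rewrite lee_fin.
  apply/lee_addgt0Pr => e e0; have [a ha] := i e e0.
  by apply: ge_ereal_inf; exists (h a)%:E; [exists a|rewrite -EFinD lee_fin].
split=> [a|e e0].
  by rewrite -lee_fin vE; apply: ereal_inf_lbound; exists a.
have : (ereal_inf [set (h a)%:E | a in [set: A]] < (v + e)%:E)%E.
  by rewrite -vE lte_fin ltrDl.
by move=> /ereal_inf_lt[_ [a _ <-]]; rewrite lte_fin => /ltW; exists a.
Qed.

End is_inf.

(** * Equicontinuity and passage to the limit in the Bellman equation *)

Section vanishing_limit.
Context (R : realType) (E U : pmetricType R) (b : E).
Variables (P : E -> U -> probability (borel E) R) (c : E -> U -> R) (M : R).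
Hypothesis B_compact : forall n, (0 < n)%N -> compact (Bn b n).
Hypothesis U_compact : compact [set: U].
Hypothesis c_continuous : continuous (fun xa : E * U => c xa.1 xa.2).
Hypothesis cM : forall x a, `|c x a| <= M.
Hypothesis P_variation_continuous : variation_continuous P.

Definition bellman (lam : R) (g : borel E -> R) (x : E) (a : U) : R :=
  expR (c x a - lam) * \int[P x a]_y g y.

Variables (g : nat -> borel E -> R) (lam : nat -> R) (lambda : R) (N : nat -> nat).
Hypothesis g_unit : forall k, unit_fun (g k).
Hypothesis N_ge : forall k, (k <= N k)%N.
Hypothesis g_bellman : forall k x, Bn b (N k) x ->
  is_inf (bellman (lam k) (g k) x) (g k x).
Hypothesis lam_cvg : lam k @[k --> \oo] --> lambda.

Lemma cost_near_unif x (eta : R) : 0 < eta ->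
  \forall y \near x, forall a, `|expR (c y a) - expR (c x a)| <= eta.
Proof.
move=> eta0; have eta2 : 0 < eta / 2 by rewrite divr_gt0.
have /compact_near_coveringP C := U_compact.
apply: filterS (C E (nbhs x) (fun y a => `|expR (c y a) - expR (c x a)| <= eta) _ _).
  by move=> y H a; exact: H.
move=> a _.
have ce : (fun xa : E * U => expR (c xa.1 xa.2)) xa @[xa --> (x, a)] --> expR (c x a).
  by apply: (@continuous_comp _ _ _ (fun xa : E * U => c xa.1 xa.2) expR (x, a));
    [exact: c_continuous|exact: continuous_expR].
have /cvgrPdist_le/(_ _ eta2)[[V W] /= [xV aW] VW] := ce.
exists (W, V) => //= -[a' y] /= [Wa' Vy].
have := VW (y, a') (conj Vy Wa'); have := VW (x, a') (conj (nbhs_singleton xV) Wa').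
rewrite /= !ler_norml => /andP[? ?] /andP[? ?].
by apply/andP; split; lra.
Qed.

Lemma near_Bn (x : E) : \forall y \near x & k \near \oo, Bn b (N k) y.
Proof.
exists (ball x 1, [set k | (Num.truncn (mdist b x + 1)).+1 <= k]%N) => /=.
  split; first exact: nbhsx_ballx.
  by exists (Num.truncn (mdist b x + 1)).+1.
move=> [y k] /= []; rewrite ballEmdist /= => xy tk; rewrite /Bn /=.
have d0 : 0 <= mdist b x + 1 by rewrite addr_ge0// mdist_ge0.
have /andP[_ t] := truncn_itv d0.
apply: (le_trans (metric_triangle b x y)); apply: (@le_trans _ _ k%:R).
  apply: (@le_trans _ _ (mdist b x + 1)); first by rewrite lerD2l ltW.
  by rewrite (le_trans (ltW t))// ler_nat.
by rewrite ler_nat.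
Qed.

Lemma expRN_lam_cvg : expR (- lam k) @[k --> \oo] --> expR (- lambda).
Proof. by apply: continuous_cvg; [exact: continuous_expR|exact: cvgN]. Qed.

(** Both values are infima over the same controls of quantities that are close uniformly in the
    control and in [k]: the kernel estimate holds for all test functions with values in [0, 1] at
    once, so in particular for [g k]. *)
Lemma bellman_equicontinuous (x : E) (eta : R) : 0 < eta ->
  \forall y \near x & k \near \oo, `|g k y - g k x| <= eta.
Proof.
move=> eta0.
(* [C] bounds [expR (- lam k)] for large [k]. Cost and kernel errors get [eta / (C * 2)] each, the
   latter divided further by [expR M] to absorb the factor [expR (c x a)]. *)
pose C := expR (- lambda) + 1.
have C0 : 0 < C by rewrite addr_gt0// expR_gt0.
have D0 : 0 < C * 2 by rewrite mulr_gt0.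
have e1 : 0 < eta / (C * 2) by rewrite divr_gt0.
have e2 : 0 < eta / (C * 2) / expR M by rewrite divr_gt0// expR_gt0.
have Ck : \forall k \near \oo, expR (- lam k) <= C.
  apply: (cvgr_le _ expRN_lam_cvg); by rewrite /C ltrDl.
have H1 := cost_near_unif x e1.
have H2 := Rintegral_near_unif P_variation_continuous U_compact x e2.
have [[V W] /= [xV oW] VW] := near_Bn x.
near=> y k => /=.
have By : Bn b (N k) y.
  by apply: (VW (y, k)); split => /=; [near: y; exact: xV|near: k; exact: oW].
have Bx : Bn b (N k) x.
  by apply: (VW (x, k)); split => /=; [exact: nbhs_singleton|near: k; exact: oW].
have K1 : forall a, `|expR (c y a) - expR (c x a)| <= eta / (C * 2).
  by near: y; exact: H1.
have K2 : forall a (f : borel E -> R), unit_fun f ->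
    `|\int[P y a]_z f z - \int[P x a]_z f z| <= eta / (C * 2) / expR M.
  by near: y; exact: H2.
have LC : expR (- lam k) <= C by near: k; exact: Ck.
apply: is_inf_dist (g_bellman By) (g_bellman Bx) _ => a; rewrite /bellman.
have {}K1 := K1 a; have {}K2 := K2 a _ (g_unit k).
have /andP[I0 I1] := unit_fun_Rintegral01 (P y a) (g_unit k).
rewrite !expRD; set I := Rintegral _ _ _ in K2 I0 I1 *; set J := Rintegral _ _ _ in K2 *.
rewrite (_ : _ - _ = expR (- lam k) * ((expR (c y a) - expR (c x a)) * I +
  expR (c x a) * (I - J))); last by ring.
rewrite normrM ger0_norm ?expR_ge0//.
apply: (@le_trans _ _ (C * (eta / (C * 2) + eta / (C * 2)))).
  apply: ler_pM => //.
  apply: (le_trans (ler_normD _ _)); apply: lerD.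
    by rewrite normrM (ger0_norm I0) (le_trans _ K1)// ler_piMr.
  rewrite normrM ger0_norm ?expR_ge0//.
  have cx : expR (c x a) <= expR M by rewrite ler_expR (le_trans (ler_norm _)).
  apply: (le_trans (ler_pM (expR_ge0 _) (normr_ge0 _) cx K2)).
  by rewrite mulrC divfK// gt_eqF// expR_gt0.
rewrite le_eqVlt; apply/orP; left; apply/eqP; field; exact: lt0r_neq0.
Unshelve. all: end_near. Qed.

Lemma Bn_exhaust (x : E) : exists j : nat, (0 < j)%N /\ Bn b j x.
Proof.
exists (Num.truncn (mdist b x)).+1; split => //; apply: ltW.
by have /andP[] := truncn_itv (mdist_ge0 b x).
Qed.

(** An ultrafilter converges on the compact interval [0, 1] at all points [x] simultaneously, which
    replaces a diagonal extraction of subsequences. *)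
Lemma ultralimit (G : set_system nat) : UltraFilter G ->
  exists u : E -> R, forall x, g k x @[k --> G] --> u x.
Proof.
move=> UG; suff /choice[u Hu] : forall x, exists l : R, g k x @[k --> G] --> l by exists u.
move=> x; have [|l [_ Gl]] := @segment_compact R 0 1 (g k x @[k --> G]) _.
  apply: (@filterE _ G) => k; rewrite /= in_itv /=; exact: ((g_unit k).2 x).
exists l => V lV; have [//|GV] := in_ultra_setVsetC [set k | V (g k x)] UG.
by have [y [nVy Vy]] := Gl (~` V) V GV lV.
Qed.

Section ultralimit.
Variables (G : set_system nat) (u : E -> R).
Context {PG : ProperFilter G}.
Hypothesis ooG : \oo `<=` G.
Hypothesis g_cvg : forall x, g k x @[k --> G] --> u x.

Lemma g_near (x : E) (eta : R) : 0 < eta -> \forall k \near G, `|g k x - u x| <= eta.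
Proof.
by move=> eta0; have /cvgrPdistC_le := @g_cvg x; apply.
Qed.

Lemma limit01 x : 0 <= u x <= 1.
Proof.
apply/andP; split; apply/ler_addgt0Pr => e e0.
  have [k] := @filter_ex _ _ PG _ (g_near x e0).
  by have /andP[? ?] := (g_unit k).2 x; rewrite ler_norml => /andP[? ?]; lra.
have [k] := @filter_ex _ _ PG _ (g_near x e0).
by have /andP[? ?] := (g_unit k).2 x; rewrite ler_norml => /andP[? ?]; lra.
Qed.

Lemma limit_near (x : E) (eta : R) : 0 < eta -> \forall y \near x, `|u y - u x| <= eta.
Proof.
move=> eta0; have [[V W] /= [xV oW] VW] := bellman_equicontinuous x eta0.
apply: filterS xV => y Vy; apply/ler_addgt0Pr => e e0.
have e2 : 0 < e / 2 by rewrite divr_gt0.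
have [k [Wk [H1 H2]]] : exists k, W k /\ `|g k x - u x| <= e / 2 /\ `|g k y - u y| <= e / 2.
  apply: (@filter_ex _ _ PG); apply: filterI; first exact: ooG.
  by apply: filterI; exact: g_near.
have := VW (y, k) (conj Vy Wk); rewrite /=; move: H1 H2; rewrite !ler_norml.
by move=> /andP[? ?] /andP[? ?] /andP[? ?]; apply/andP; split; lra.
Qed.

Lemma limit_continuous : continuous u.
Proof.
by move=> x; apply/cvgrPdistC_le => e e0; exact: limit_near.
Qed.

Lemma limit_unit : unit_fun (u : borel E -> R).
Proof.
by split; [exact: continuous_borel_measurable limit_continuous|exact: limit01].
Qed.

(** Pointwise convergence and equicontinuity give uniform convergence near each point, and
    compactness of [B_j] makes it uniform on the ball. *)
Lemma limit_uniform (j : nat) (eta : R) : (0 < j)%N -> 0 < eta ->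
  \forall k \near G, forall y, Bn b j y -> `|g k y - u y| <= eta.
Proof.
move=> j0 eta0; have e3 : 0 < eta / 3 by rewrite divr_gt0.
have /compact_near_coveringP C := B_compact j0.
apply: (C nat G (fun k y => `|g k y - u y| <= eta)) => x Bx.
have [[V W] /= [xV oW] VW] := bellman_equicontinuous x e3.
exists (V `&` [set y | `|u y - u x| <= eta / 3],
        W `&` [set k | `|g k x - u x| <= eta / 3]) => /=.
  split; apply: filterI => //; [exact: limit_near|exact: ooG|exact: g_near].
move=> [y k] /= [[Vy uy] [Wk gk]].
have := VW (y, k) (conj Vy Wk); rewrite /=; move: uy gk; rewrite !ler_norml.
by move=> /andP[? ?] /andP[? ?] /andP[? ?]; apply/andP; split; lra.
Qed.

(** The equation for a suitable [k] differs from the limit one by three errors: the eigenvalue, the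
    values on [B_j], and the tail off [B_j], which tightness makes small for all controls at
    once. *)
Lemma limit_bellman (x : E) : is_inf (bellman lambda (u : borel E -> R) x) (u x).
Proof.
apply: is_inf_lim => eta eta0.
(* In [D], the 1 accounts for the eigenvalue error and the 2 for the error on [B_j] plus the
   tail. *)
pose D := expR M * (1 + expR (- lambda) * 2).
have D0 : 0 < D by rewrite mulr_gt0 ?expR_gt0// addr_gt0// mulr_gt0// expR_gt0.
have e1 : 0 < eta / D by rewrite divr_gt0.
have [j [j0 Tj]] : exists j : nat, (0 < j)%N /\
    forall a, fine (P x a (~` Bn b j)) <= eta / D.
  have [j _ Hj] := tight_near P_variation_continuous U_compact b x e1.
  by exists j.+1; split => //; apply: Hj => /=.
have [[V W] /= [xV oW] VW] := near_Bn x.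
have [k [[Wk Lk] [gk uk]]] : exists k,
    (W k /\ `|expR (- lam k) - expR (- lambda)| <= eta / D) /\
    (`|g k x - u x| <= eta /\ forall y, Bn b j y -> `|g k y - u y| <= eta / D).
  apply: (@filter_ex _ _ PG); apply: filterI.
    apply: filterI; first exact: ooG.
    by apply: ooG; have /cvgrPdistC_le := expRN_lam_cvg; apply.
  by apply: filterI; [exact: g_near|exact: limit_uniform].
exists (bellman (lam k) (g k) x), (g k x); split => // [|a].
  by apply: g_bellman; apply: (VW (x, k)); split => //=; exact: nbhs_singleton.
rewrite /bellman !expRD.
have K : `|\int[P x a]_y g k y - \int[P x a]_y u y| <= eta / D * 2.
  have /le_trans -> // := unit_fun_Rintegral_dist (P x a) (measurable_Bn b j) (g_unit k)
    limit_unit (ltW e1) uk.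
  by rewrite mulr_natr mulr2n lerD2l.
have /andP[I0 I1] := unit_fun_Rintegral01 (P x a) (g_unit k).
set I := Rintegral _ _ _ in K I0 I1 *; set J := Rintegral _ _ _ in K *.
rewrite (_ : _ - _ = expR (c x a) * ((expR (- lam k) - expR (- lambda)) * I +
  expR (- lambda) * (I - J))); last by ring.
have cx : expR (c x a) <= expR M by rewrite ler_expR (le_trans (ler_norm _)).
rewrite normrM ger0_norm ?expR_ge0//.
apply: (@le_trans _ _ (expR M * (eta / D + expR (- lambda) * (eta / D * 2)))).
  apply: ler_pM => //.
  apply: (le_trans (ler_normD _ _)); apply: lerD.
    by rewrite normrM (ger0_norm I0) (le_trans _ Lk)// ler_piMr.
  by rewrite normrM ger0_norm ?expR_ge0// ler_wpM2l// expR_ge0.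
rewrite (_ : _ * _ = D * (eta / D)); last by rewrite /D; ring.
by rewrite mulrC divfK// gt_eqF.
Qed.

End ultralimit.

Lemma vanishing_limit : exists (G : set_system nat) (u : E -> R),
  [/\ ProperFilter G, \oo `<=` G, continuous u, unit_fun (u : borel E -> R) &
   (forall j eta, (0 < j)%N -> 0 < eta ->
     \forall k \near G, forall y, Bn b j y -> `|g k y - u y| <= eta) /\
   forall x, is_inf (bellman lambda (u : borel E -> R) x) (u x)].
Proof.
have [G [UG ooG]] := ultraFilterLemma (eventually_filter : ProperFilter \oo).
have [u gu] := ultralimit UG.
have PG : ProperFilter G by exact: (@ultra_proper _ _ UG).
exists G, u; split => //.
- exact: limit_continuous gu.
- exact: limit_unit gu.
- split; first by move=> j eta j0 eta0; exact: (limit_uniform ooG gu j0 eta0).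
  by move=> x; exact: (limit_bellman ooG gu).
Qed.

End vanishing_limit.

(** [phi] is not claimed to be increasing; [k < phi k] already sends it to infinity. *)
Lemma limn_sup_subsequence (R : realType) (u : R^nat) : bounded_fun u ->
  exists2 phi : nat -> nat, (forall k, (k < phi k)%N) &
    u (phi k) @[k --> \oo] --> limn_sup u.
Proof.
move=> bu; set l := limn_sup u.
have ub := bounded_fun_has_ubound bu; have lb := bounded_fun_has_lbound bu.
have lE : l = inf (range (sups u)) by exact: limn_supE.
have hinf : has_inf (range (sups u)).
  split; first by exists (sups u 0), 0.
  exact: bounded_fun_has_lbound_sups.
have /choice[phi phiP] : forall k, exists n, (k < n)%N /\ `|u n - l| < k.+1%:R^-1.
  move=> k; have e0 : 0 < k.+1%:R^-1 :> R by rewrite invr_gt0.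
  have [_ [j _ <-] jl] := inf_adherent e0 hinf.
  rewrite -lE in jl.
  have hs m : has_sup (sdrop u m).
    by split; [exists (u m), m => //=|exact: has_ubound_sdrop].
  (* An index beyond [k] gives [k < phi k]; one beyond [j] keeps [u n] below [sups u j], hence close
     to [l] from above. *)
  have lm : l <= sups u (maxn k.+1 j).
    by rewrite lE; apply: ge_inf; [exact: hinf.2|exists (maxn k.+1 j)].
  have [_ [n /= mn <-] ln] := sup_adherent e0 (hs (maxn k.+1 j)).
  exists n; split; first by apply: leq_trans mn; rewrite leq_maxl.
  have nj : u n <= sups u j.
    apply: ub_le_sup; first exact: (hs j).2.
    by exists n => //=; apply: leq_trans mn; rewrite leq_maxr.
  rewrite ltr_distl; apply/andP; split; last exact: le_lt_trans nj jl.
  by apply: le_lt_trans ln; rewrite lerD2r.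
exists phi; first by move=> k; have [] := phiP k.
apply/cvgrPdistC_lt => e e0; near=> k.
have [_ /lt_trans -> //] := phiP k.
by near: k; exact: near_infty_natSinv_lt (PosNum e0).
Unshelve. all: end_near. Qed.

(** * The approximating equations and bounds on their eigenvalues *)

Section approximation.
Context (R : realType) (E U : pmetricType R) (b : E).
Variables (P : E -> U -> probability (borel E) R) (c : E -> U -> R) (M : R).
Variable mu : probability (borel E) R.
Hypothesis cM : forall x a, `|c x a| <= M.
Variables (n : nat) (w : E -> R) (lam : R).
Hypothesis mu_Bn : mu (~` Bn b n) = 0%E.
Hypothesis w_continuous : continuous w.
Hypothesis w_bounded : exists Mw : R, forall x, `|w x| <= Mw.
Hypothesis w_bellman : forall x, (expR (w x))%:E =
    ereal_inf [set ((expR (cn b c n x a - lam))%:E *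
                    \int[tildeP b mu P n x a]_y (expR (w y))%:E)%E
              | a in [set: U]].
Hypothesis w_sup : ereal_sup [set (w x)%:E | x in Bn b n.+1] = 0%E.

(** [cn] is a convex combination of [c x a] and the infimum of [c]. *)
Lemma cn_le x a : cn b c n x a <= c x a.
Proof.
have cinf : inf [set c xa.1 xa.2 | xa in [set: E * U]] <= c x a.
  apply: ge_inf; last by exists (x, a).
  by exists (- M) => _ [xa _ <-]; have := cM xa.1 xa.2; rewrite ler_norml => /andP[].
rewrite /cn; have := dist_set_ge0 b n x; set D := dist_set _ _; set C := inf _ in cinf *.
move=> D0; case: (leP D 1) => D1.
  rewrite max_r ?subr_ge0//.
  rewrite -subr_ge0 (_ : _ - _ = D * (c x a - C)); first by rewrite mulr_ge0// subr_ge0.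
  by ring.
by rewrite max_l ?subr_le0 ?(ltW D1)// mul0r add0r mul1r.
Qed.

Lemma cn_in x a : Bn b n x -> cn b c n x a = c x a.
Proof.
move=> Bx; rewrite /cn dist_set0// subr0 max_r ?ler01// mul1r min_l ?ler01//.
by rewrite mul0r addr0.
Qed.

Let u : borel E -> R := expR \o w.

Lemma approx_le1 x : Bn b n.+1 x -> w x <= 0.
Proof.
by move=> Bx; rewrite -lee_fin -[leRHS]w_sup; apply: ereal_sup_ubound; exists x.
Qed.

Lemma subset_BnS : Bn b n `<=` Bn b n.+1.
Proof. by move=> x /le_trans; apply; rewrite ler_nat. Qed.

Let mu_fun : measurable_fun setT u.
Proof.
apply: continuous_borel_measurable => x.
by apply: continuous_comp; [exact: w_continuous|exact: continuous_expR].
Qed.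

Let mB : measurable (Bn b n : set (borel E)). Proof. exact: measurable_Bn. Qed.

Lemma approx_restrict_unit : unit_fun (u \_ (Bn b n) : borel E -> R).
Proof.
split; first by apply/(measurable_restrictT _ _).1 => //; exact: measurable_funTS.
move=> y; rewrite /patch; case: ifPn => [/set_mem yB|_]; last by rewrite lexx ler01.
by rewrite expR_ge0 -expR0 ler_expR; apply: approx_le1; exact: subset_BnS.
Qed.

(** Since [mu] is carried by [B_n], this is the full integral of [u]; the restriction keeps the
    integrand in [0, 1]. *)
Let kn := \int[mu]_y (u \_ (Bn b n)) y.

(* The function [g_n]: the restart with law [mu] after an exit from [B_n] is
   absorbed in the value taken off [B_n]. *)
Definition approx (y : borel E) : R := if y \in (Bn b n : set (borel E)) then u y else kn.

Lemma approx_unit : unit_fun approx.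
Proof.
have [mr r01] := approx_restrict_unit; split.
  apply: measurable_fun_ifT => //.
  apply: (measurable_fun_bool true); rewrite setTI.
  rewrite (_ : _ @^-1` _ = Bn b n)//.
  by apply/seteqP; split => z; [exact: set_mem|exact: mem_set].
move=> y; rewrite /approx; have := r01 y; rewrite /patch.
by case: ifP => // _ _; exact: unit_fun_Rintegral01 approx_restrict_unit.
Qed.

Lemma approxE y : Bn b n y -> approx y = expR (w y).
Proof. by move=> By; rewrite /approx mem_set. Qed.

Lemma tildeP_approx x a : Bn b n x ->
  (\int[tildeP b mu P n x a]_y (expR (w y))%:E = (\int[P x a]_y approx y)%:E)%E.
Proof.
move=> Bx; have mC : measurable (~` Bn b n : set (borel E)) by exact: measurableC.
have mue : measurable_fun setT (fun y : borel E => (expR (w y))%:E).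
  by apply/measurable_EFinP; exact: mu_fun.
have u0 y : (0 <= (expR (w y))%:E)%E by rewrite lee_fin expR_ge0.
rewrite tildeP_integral//.
have -> : (\int[mu]_y (expR (w y))%:E = kn%:E)%E.
  rewrite (ge0_negligible_integral mC)// setTD setCK integral_mkcond.
  under eq_integral do rewrite restrict_EFin.
  by rewrite unit_fun_integralE//; exact: approx_restrict_unit.
rewrite -unit_fun_integralE; last exact: approx_unit.
rewrite -[in RHS](setUv (Bn b n)) ge0_integral_setU//; last 3 first.
- rewrite setUv; apply/measurable_EFinP; exact: approx_unit.1.
- by move=> y _; rewrite lee_fin; have /andP[] := approx_unit.2 y.
- exact/disj_setPCl.
congr (_ + _)%E.
  by apply: eq_integral => y yB; rewrite /approx yB.
rewrite [RHS](eq_integral (cst kn%:E)); last first.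
  by move=> y /set_mem yB; rewrite /approx memNset.
by rewrite integral_cst// muleC.
Qed.

Lemma approx_bellman x : Bn b n x -> is_inf (bellman P c lam approx x) (approx x).
Proof.
move=> Bx; apply/is_infP; rewrite approxE// w_bellman; congr ereal_inf.
apply: eq_imagel => a _.
by rewrite /bellman EFinM cn_in// tildeP_approx.
Qed.

(** [tildeP] has mass at most 1 and lives on [B_n], where [u <= 1], so the integral in the equation
    is at most 1 for every control. *)
Lemma approx_upper x a : Bn b n.+1 x -> w x <= c x a - lam.
Proof.
move=> Bx; rewrite -ler_expR -lee_fin w_bellman.
apply: (@le_trans _ _ ((expR (cn b c n x a - lam))%:E * 1)%E).
  apply: ge_ereal_inf; exists ((expR (cn b c n x a - lam))%:E *
    \int[tildeP b mu P n x a]_y (expR (w y))%:E)%E; first by exists a.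
  apply: lee_wpmul2l; first by rewrite lee_fin expR_ge0.
  apply: tildeP_integral_le1 => //.
  - by apply/measurable_EFinP; exact: mu_fun.
  - move=> y By; rewrite lee_fin -expR0 ler_expR; apply: approx_le1.
    exact: subset_BnS.
by rewrite mule1 lee_fin ler_expR lerD2r cn_le.
Qed.

(** Where [w] almost attains its supremum 0, [approx_upper] forces a large cost under every control.
    This bounds [lam] above and, under (iii), localises near-maximisers. *)
Lemma approx_near_max (e : R) : 0 < e -> exists x,
  [/\ Bn b n.+1 x, - e < w x & forall a, lam - e <= c x a].
Proof.
move=> e0; have : ((- e)%:E < ereal_sup [set (w x)%:E | x in Bn b n.+1])%E.
  by rewrite w_sup lte_fin oppr_lt0.
move=> /ereal_sup_gt[_ [x Bx <-]]; rewrite lte_fin => wx; exists x; split => // a.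
by have := approx_upper a Bx; lra.
Qed.

Lemma eigenvalue_le : lam <= M.
Proof.
apply/ler_addgt0Pr => e e0; have [x [_ _ /(_ point)]] := approx_near_max e0.
by have := cM x point; rewrite ler_norml => /andP[]; lra.
Qed.

Lemma eigenvalue_ge : - M <= lam.
Proof.
(* If [lam < - M] then [inf u] over [B_n] would exceed itself by a factor > 1. *)
rewrite leNgt; apply/negP => lM.
have [Mw wM] := w_bounded.
pose S := [set expR (w y) | y in Bn b n].
have bn : Bn b n b by rewrite /Bn /= mdistxx.
have S_lb : lbound S (expR (- Mw)).
  by move=> _ [y _ <-]; rewrite ler_expR; have := wM y; rewrite ler_norml => /andP[].
have hS : has_inf S by split; [exists (expR (w b)), b|exists (expR (- Mw))].
set r := inf S.
have r0 : 0 < r.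
  by apply: (lt_le_trans (expR_gt0 (- Mw))); apply: lb_le_inf => //; exact: hS.1.
have rS y : Bn b n y -> r <= expR (w y).
  by move=> By; apply: ge_inf; [exact: hS.2|exists y].
(* The restart cannot fall below the infimum [r], because [mu] is carried by [B_n]. *)
have rk : r <= kn.
  have -> : r = \int[mu]_y (r * \1_(Bn b n) y).
    rewrite RintegralZl//; last first.
      by apply: unit_fun_integrable; exact: unit_fun_indic.
    rewrite /Rintegral integral_indic// setIT.
    have := probability_setC mu mB; rewrite mu_Bn => /eqP.
    rewrite -(@fineK _ (mu (Bn b n))) ?fin_num_measure// -EFinB eqe eq_sym subr_eq0.
    by move=> /eqP <-; rewrite mulr1.
  apply: le_Rintegral => //.
  - rewrite (_ : _ \o _ = (fun y => r%:E * (EFin \o \1_(Bn b n)) y)%E); last first.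
      by apply/funext => y /=; rewrite EFinM.
    by apply: integrableZl => //; apply: unit_fun_integrable; exact: unit_fun_indic.
  - by apply: unit_fun_integrable; exact: approx_restrict_unit.
  - move=> y _; rewrite indicE /patch; case: ifPn => yB; last by rewrite mulr0.
    by rewrite mulr1; apply: rS; exact: set_mem.
have rg y : r <= approx y.
  by rewrite /approx; case: ifPn => // /set_mem; exact: rS.
have er : expR (- M - lam) * r <= r.
  apply: lb_le_inf; first exact: hS.1.
  move=> _ [y By <-]; rewrite -approxE//; have [_ i] := approx_bellman By.
  apply/ler_addgt0Pr => e e0; have [a] := i e e0; apply: le_trans.
  apply: ler_pM; [exact: expR_ge0|exact: ltW| |].
    by rewrite ler_expR; have := cM y a; rewrite ler_norml => /andP[]; lra.
  rewrite -[leLHS](Rintegral_prob_cst (P y a)); apply: le_Rintegral => //.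
  - exact: finite_measure_integrable_cst.
  - by apply: unit_fun_integrable; exact: approx_unit.
have : 1 < expR (- M - lam) by rewrite expR_gt1; lra.
by move=> e1; nra.
Qed.

End approximation.

(** * Positivity and normalisation of solutions *)

Section hitting.
Context (R : realType) (E U : pmetricType R) (b : E).
Variables (P : E -> U -> probability (borel E) R) (c : E -> U -> R) (M : R).
Hypothesis B_compact : forall n, (0 < n)%N -> compact (Bn b n).
Hypothesis cM : forall x a, `|c x a| <= M.
Hypothesis P_variation_continuous : variation_continuous P.

(** From [c >= - M] and [lam <= M], each step has weight at least [expR (- M - M)]; discarding the
    mass of [g] off [B_n] then puts [v] in the setting of [hitting_le]. With [g] distinct from [v]
    this covers the approximants, with [g = v] the limit. *)
Lemma bellman_hitting_le (n : nat) (v : E -> R) (g : borel E -> R) (lam : R) :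
  (0 < n)%N -> continuous v -> (forall y, 0 <= v y) -> unit_fun g ->
  (forall y, Bn b n y -> g y = v y) -> lam <= M ->
  (forall y, Bn b n y -> is_inf (bellman P c lam g y) (g y)) ->
  forall x m eps, Bn b n x -> 0 <= eps ->
  ((expR (- M - M) ^+ m * eps)%:E * inf_hatP b P n m x [set y | (eps < v y)%R]
    <= (v x)%:E)%E.
Proof.
move=> n0 cv v0 ug gv lamM gb x m eps Bx eps0.
have mB := measurable_Bn b n.
have ur : unit_fun (v \_ (Bn b n) : borel E -> R).
  split.
    apply/(measurable_restrictT _ _).1 => //; apply: measurable_funTS.
    exact: continuous_borel_measurable.
  move=> y; rewrite /patch; case: ifPn => [/set_mem yB|_]; last by rewrite lexx ler01.
  by rewrite -gv//; exact: ug.2.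
apply: (hitting_le P_variation_continuous (B_compact n0) mB cv v0 ur) => //.
move=> y By e e0; have [_ /(_ e e0)[a ga]] := gb y By.
exists a; rewrite -gv//; apply: le_trans ga; apply: ler_pM.
- exact: expR_ge0.
- by have /andP[] := unit_fun_Rintegral01 (P y a) ur.
- by rewrite ler_expR; have := cM y a; rewrite ler_norml => /andP[? ?]; lra.
- apply: unit_fun_Rintegral_le => // z; rewrite /patch; case: ifPn => [/set_mem zB|_].
    by rewrite gv.
  by have /andP[] := ug.2 z.
Qed.

End hitting.

Lemma compact_sub_Bn (R : realType) (E : pmetricType R) (b : E) (K : set E) :
  compact K -> \forall j \near \oo, K `<=` Bn b j.
Proof.
move=> /compact_near_coveringP C; apply: (C nat \oo (fun j y => Bn b j y)) => x _.
exact: (@near_Bn _ _ b id).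
Qed.

(** The Bellman operator is homogeneous, so division by the supremum preserves the equation, and
    positivity allows the logarithm. *)
Lemma normalized_solution (R : realType) (E U : pmetricType R)
    (P : E -> U -> probability (borel E) R) (c : E -> U -> R) (lambda : R) (u : E -> R) :
  continuous u -> unit_fun (u : borel E -> R) -> (forall x, 0 < u x) ->
  (forall x, is_inf (bellman P c lambda (u : borel E -> R) x) (u x)) ->
  exists w : E -> R,
    [/\ continuous w,
        ereal_sup [set (w x)%:E | x in [set: E]] = 0%E &
        forall x,
          (expR (w x))%:E =
          ereal_inf [set ((expR (c x a - lambda))%:E *
                          \int[P x a]_y (expR (w y))%:E)%E
                    | a in [set: U]]].
Proof.
move=> cu uu u0 bu; pose S := sup [set u x | x in [set: E]].
have hS : has_sup [set u x | x in [set: E]].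
  split; first by exists (u point), point.
  by exists 1 => _ [x _ <-]; have /andP[] := uu.2 x.
have uS x : u x <= S by apply: ub_le_sup; [exact: hS.2|exists x].
have S0 : 0 < S by exact: lt_le_trans (u0 point) (uS point).
have uS0 x : 0 < u x / S by rewrite divr_gt0.
have uS01 x : 0 <= u x / S <= 1 by rewrite ltW//= ler_pdivrMr// mul1r.
exists (fun x => ln (u x / S)); split.
- move=> x; apply: (@continuous_comp _ _ _ (fun x => u x / S) (@ln R)).
    by apply: cvgMl; exact: cu.
  exact: continuous_ln.
- apply/eqP; rewrite eq_le; apply/andP; split.
    apply: ge_ereal_sup => _ [x _ <-]; rewrite lee_fin.
    by apply: ln_le0; have /andP[] := uS01 x.
  apply/lee_addgt0Pr => e e0.
  (* With this margin a near-maximiser satisfies [S * expR (- e) < u x], that is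
     [ln (u x / S) > - e]. *)
  have Se : 0 < S * (1 - expR (- e)).
    by rewrite mulr_gt0// subr_gt0 expR_lt1 oppr_lt0.
  have [_ [x _ <-] ux] := sup_adherent Se hS.
  apply: (@le_trans _ _ ((ln (u x / S))%:E + e%:E)%E); last first.
    by rewrite leeD2r//; apply: ereal_sup_ubound; exists x.
  rewrite -EFinD lee_fin -lerBlDr sub0r -[leLHS](expRK (- e)) ler_ln ?posrE ?expR_gt0//.
  rewrite ler_pdivlMr// mulrC ltW//.
  by move: ux; rewrite -/S mulrBr mulr1 opprB addrC subrK.
- move=> x; rewrite lnK ?posrE//.
  have uv : unit_fun (fun y : borel E => u y / S : R).
    by split => //; apply: measurable_funM => //; exact: uu.1.
  rewrite [in RHS](_ : [set _ | _ in _] =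
      [set (bellman P c lambda (u : borel E -> R) x a / S)%:E | a in [set: U]]).
    apply/is_infP; have [l i] := bu x; split.
      by move=> a; rewrite ler_pM2r ?invr_gt0.
    move=> e e0; have [|a ha] := i (e * S); first by rewrite mulr_gt0.
    exists a; rewrite ler_pdivrMr// mulrDl divfK ?gt_eqF//.
  apply: eq_imagel => a _; under eq_integral do rewrite lnK ?posrE//.
  rewrite unit_fun_integralE//= -EFinM /bellman -mulrA; congr (_ * _)%:E.
  by rewrite RintegralZr//; exact: unit_fun_integrable.
Qed.

(** * Assembly: subsequence, nontrivial limit under (iii) or (iv), positivity by (ii) *)

Theorem theorem4p4 (R : realType) (E U : pmetricType R) (b : E)
  (P : E -> U -> probability (borel E) R) (c : E -> U -> R)
  (mu : probability (borel E) R)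
  (w_ : nat -> E -> R) (lambda_ : nat -> R) (lambda : R)
  (E_locally_compact : locally_compact [set: E])
  (E_separable : separable E)
  (B_compact : forall n, (0 < n)%N -> compact (Bn b n))
  (U_compact : compact [set: U])
  (P_measurable : forall D : set (borel E), measurable D ->
    measurable_fun [set: borel (E * U)%type]
      (fun xa : borel (E * U)%type => P xa.1 xa.2 D))
  (c_continuous : continuous (fun xa : E * U => c xa.1 xa.2))
  (c_bounded : exists M : R, forall x a, `|c x a| <= M)
  (c_not_constant : ~ exists k : R, forall x a, c x a = k)
  (c_sup_ge0 : 0 <= sup [set c xa.1 xa.2 | xa in [set: E * U]])
  (mu_support : msupport mu `<=` Bn b 1)
  (E_not_compact : ~ compact [set: E])
  (* condition (i) *)
  (P_variation_continuous :
    forall (x_ : nat -> E) (a_ : nat -> U) (x : E) (a : U),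
      x_ k @[k --> \oo] --> x -> a_ k @[k --> \oo] --> a ->
      ereal_sup [set `|P (x_ k) (a_ k) A - P x a A|%E
                | A in (measurable : set (set (borel E)))] @[k --> \oo]
        --> (0 : R)%:E)
  (* condition (ii) *)
  (P_reach : forall n, (0 < n)%N -> forall x, Bn b n x ->
    forall O : set E, open O -> O `&` Bn b n !=set0 ->
    exists m, (0 < m)%N /\ (0 < inf_hatP b P n m x O)%E)
  (w_continuous : forall n, (0 < n)%N -> continuous (w_ n))
  (w_bounded : forall n, (0 < n)%N -> exists M : R, forall x, `|w_ n x| <= M)
  (w_bellman : forall n, (0 < n)%N -> forall x,
    (expR (w_ n x))%:E =
    ereal_inf [set ((expR (cn b c n x a - lambda_ n))%:E *
                    \int[tildeP b mu P n x a]_y (expR (w_ n y))%:E)%E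
              | a in [set: U]])
  (w_sup : forall n, (0 < n)%N ->
    ereal_sup [set (w_ n x)%:E | x in Bn b n.+1] = 0%E)
  (lambdaE : lambda = limn_sup lambda_)
  (* condition (iii) or condition (iv) *)
  (iii_or_iv :
    (exists eps : R, 0 < eps /\
      compact [set x | lambda - eps <= inf [set c x a | a in [set: U]]]) \/
    (exists (x : E) (m N : nat) (eps : R),
      [/\ (0 < m)%N, (0 < N)%N, 0 < eps &
        (0 < ereal_inf [set inf_hatP b P n m x [set y | (eps < expR (w_ n y))%R]
                       | n in [set n | (N <= n)%N]])%E])) :
  exists w : E -> R,
    [/\ continuous w,
        ereal_sup [set (w x)%:E | x in [set: E]] = 0%E &
        forall x,
          (expR (w x))%:E =
          ereal_inf [set ((expR (c x a - lambda))%:E *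
                          \int[P x a]_y (expR (w y))%:E)%E
                    | a in [set: U]]].
Proof.
have [M cM] := c_bounded.
have mu_Bn n : (0 < n)%N -> mu (~` Bn b n) = 0%E.
  move=> n0; apply: msupport_null => //; first exact: measurable_Bn.
  by move=> x /mu_support /le_trans; apply; rewrite ler_nat.
have lamM n : (0 < n)%N -> lambda_ n <= M.
  move=> n0; apply: (eigenvalue_le cM (mu_Bn n n0) _ (w_bellman n n0) (w_sup n n0)).
  exact: w_continuous.
have lam_bounded : bounded_fun lambda_.
  (* The hypotheses start at [n = 1], so the arbitrary value [lambda_ 0] enters the bound
     separately. *)
  exists (Num.max `|M| `|lambda_ 0|); split; first exact: num_real.
  move=> z Mz [|n] _ /=; first by rewrite (le_trans _ (ltW Mz))// le_max lexx orbT.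
  apply: (le_trans _ (ltW Mz)); rewrite le_max; apply/orP; left.
  apply: (@le_trans _ _ M); last exact: ler_norm.
  rewrite ler_norml lamM// andbT.
  exact: (eigenvalue_ge cM (mu_Bn _ _) (w_continuous _ _) (w_bounded _ _)
    (w_bellman _ _) (w_sup _ _)).
have [phi phi_gt lam_phi] := limn_sup_subsequence lam_bounded.
rewrite -lambdaE in lam_phi.
have phi0 k : (0 < phi k)%N by exact: leq_trans (phi_gt k).
have lamM' : lambda <= M.
  by apply: (cvgr_to_le lam_phi); apply: nearW => k; exact: lamM.
pose g k := approx b mu (phi k) (w_ (phi k)).
have g_unit k : unit_fun (g k).
  by apply: approx_unit; [exact: w_continuous|exact: w_sup].
have g_bellman k x : Bn b (phi k) x ->
    is_inf (bellman P c (lambda_ (phi k)) (g k) x) (g k x).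
  apply: approx_bellman => //.
  - exact: mu_Bn.
  - exact: w_continuous.
  - exact: w_bellman.
  - exact: w_sup.
have phi_ge k : (k <= phi k)%N by exact: ltnW.
have [G [u [PG ooG cu uu [unif ub]]]] := vanishing_limit B_compact U_compact
  c_continuous cM P_variation_continuous g_unit phi_ge g_bellman lam_phi.
have u0 x : 0 <= u x by have /andP[] := uu.2 x.
have [x0 ux0] : exists x, 0 < u x.
  case: iii_or_iv => [[eps [eps0 Kc]]|[x [m [N [eps [m0 N0 eps0 H]]]]]].
    have [j _ Kj] := compact_sub_Bn b Kc.
    have e2 : 0 < eps / 2 by rewrite divr_gt0.
    (* At a near-maximiser [u_n] exceeds [expR (- (eps / 2))]; approximating within half of that
       leaves the limit positive. *)
    have d0 : 0 < expR (- (eps / 2)) / 2 by rewrite divr_gt0 ?expR_gt0.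
    have [k [[jk lamk] gk]] : exists k,
        ((j < k)%N /\ `|lambda_ (phi k) - lambda| <= eps / 2) /\
        forall y, Bn b j.+1 y -> `|g k y - u y| <= expR (- (eps / 2)) / 2.
      apply: (@filter_ex _ _ PG); apply: filterI; last exact: unif.
      apply: ooG; apply: filterI; first by exists j.+1.
      by have /cvgrPdistC_le := lam_phi; apply.
    have [x [xB wx cx]] := approx_near_max cM (mu_Bn _ (phi0 k)) (w_continuous _ (phi0 k))
      (w_bellman _ (phi0 k)) (w_sup _ (phi0 k)) e2.
    (* The cost at [x] is at least [lambda_ (phi k) - eps / 2 >= lambda - eps], so [x] lies in the
       compact set of (iii), hence in a ball independent of [k]. *)
    have xj : Bn b j x.
      apply: (Kj j (leqnn j)) => /=; apply: lb_le_inf; first by exists (c x point), point.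
      move=> _ [a _ <-]; have := cx a; move: lamk; rewrite ler_norml.
      by move=> /andP[? ?] ?; lra.
    have xj1 : Bn b j.+1 x by apply: (le_trans xj); rewrite ler_nat.
    have xk : Bn b (phi k) x.
      by apply: (le_trans xj); rewrite ler_nat (leq_trans (ltnW jk)).
    exists x; have := gk x xj1; rewrite /g approxE// ler_norml => /andP[? ?].
    have : expR (- (eps / 2)) < expR (w_ (phi k) x) by rewrite ltr_expR.
    by move: d0 => ? ?; lra.
  set D := ereal_inf _ in H.
  have [j [j0 xj]] := Bn_exhaust b x.
  have K0 : 0 < expR (- M - M) ^+ m * eps by rewrite mulr_gt0// exprn_gt0// expR_gt0.
  have lower k : (maxn j N <= k)%N -> ((expR (- M - M) ^+ m * eps)%:E * D <= (g k x)%:E)%E.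
    rewrite geq_max => /andP[jk Nk].
    have xk : Bn b (phi k) x.
      by apply: (le_trans xj); rewrite ler_nat (leq_trans jk).
    have gE : g k x = expR (w_ (phi k) x) by rewrite /g approxE.
    rewrite gE; apply: (@le_trans _ _ ((expR (- M - M) ^+ m * eps)%:E *
      inf_hatP b P (phi k) m x [set y | (eps < expR (w_ (phi k) y))%R])%E).
      apply: lee_wpmul2l; first by rewrite lee_fin ltW.
      by apply: ereal_inf_lbound; exists (phi k) => //=; exact: leq_trans (phi_ge k).
    apply: (bellman_hitting_le B_compact cM P_variation_continuous (phi0 k) _ _ (g_unit k)
      _ (lamM _ (phi0 k)) (@g_bellman k)) => //; last exact: ltW.
    - move=> y; apply: continuous_comp; [exact: w_continuous|exact: continuous_expR].
    - by move=> y By; rewrite /g approxE.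
  (* [D] is an extended real, so a positive real lower bound is extracted before comparing with
     [u x]. *)
  have [r r0 rD] : exists2 r : R, 0 < r &
      (r%:E <= (expR (- M - M) ^+ m * eps)%:E * D)%E.
    have : (0 < (expR (- M - M) ^+ m * eps)%:E * D)%E by rewrite mule_gt0.
    case: (_ * D)%E => [r| |]; rewrite ?lte_fin => r0.
    - by exists r.
    - by exists 1 => //; rewrite leey.
    - by [].
  have r2 : 0 < r / 2 by rewrite divr_gt0.
  exists x; have [k [kN gk]] : exists k, (maxn j N <= k)%N /\
      forall y, Bn b j y -> `|g k y - u y| <= r / 2.
    apply: (@filter_ex _ _ PG); apply: filterI; last exact: unif.
    by apply: ooG; exists (maxn j N).
  have := le_trans rD (lower k kN); rewrite lee_fin => rg.
  by have := gk x xj; rewrite ler_norml => /andP[? ?]; lra.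
apply: (normalized_solution cu uu _ ub) => y.
have [j0 [j00 xj0]] := Bn_exhaust b x0; have [j [_ yj]] := Bn_exhaust b y.
(* [B_n] contains both [x0] and [y]; by (ii) the open set where [u] exceeds [u x0 / 2] is hit from
   [y] with probability bounded below over all strategies, which makes [u y] positive. *)
pose n := maxn j0 j.
have n0 : (0 < n)%N by rewrite leq_max j00.
have xn : Bn b n x0 by apply: (le_trans xj0); rewrite ler_nat leq_maxl.
have yn : Bn b n y by apply: (le_trans yj); rewrite ler_nat leq_maxr.
have ux2 : 0 < u x0 / 2 by rewrite divr_gt0.
have oO : open [set z | u x0 / 2 < u z].
  apply: (@open_comp _ _ u [set t | u x0 / 2 < t]); last exact: open_gt.
  by move=> z _; exact: cu.
have [|m [m0 Hm]] := P_reach n n0 y yn _ oO.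
  by exists x0; split => //=; rewrite ltr_pdivrMr// mulr_natr mulr2n ltrDl.
rewrite -lte_fin; apply: lt_le_trans (bellman_hitting_le B_compact cM
  P_variation_continuous n0 cu u0 uu _ lamM' (fun z _ => ub z) m yn (ltW ux2)) => //.
by rewrite mule_gt0// lte_fin mulr_gt0// exprn_gt0// expR_gt0.
Qed.
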